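(* Let $\mathscr{C}$ be an additive category, and $\eta \colon 1_{\mathscr{C}} \to 1_{\mathscr{C}}$ a natural transformation. Suppose that $\mathscr{C} = \operatorname{add} M$ for some object $M \in \mathscr{C}$, and that $\eta_M$ is a regular element of $\Gamma_M = \operatorname{Hom}_{\mathscr{C}}(M,M)$. Suppose in addition that $\Gamma_M$ is a commutative regular local ring, and that $\eta_M$ is an element in the square of its maximal ideal. Then the triangle functor $$(\mathbf{HFact}_2(\mathscr{C},1_{\mathscr{C}},\eta),\Sigma,\Delta) \to \mathbf{K_{tac}}\,\mathscr{P}(\Gamma_M/(\eta_M))$$ induced by $\operatorname{Hom}_{\mathscr{C}}(M,-) \otimes_{\Gamma_M} \Gamma_M/(\eta_M)$ is an equivalence.
   Context: $\operatorname{add} M$ is the additive closure of $M$: the full subcategory of all objects $X$ for which there exist a positive integer $n$ and morphisms $X \xrightarrow{i} M^{\oplus n} \xrightarrow{p} X$ with $p \circ i = 1_X$. Since $\eta$ is a natural transformation $1_{\mathscr{C}} \to 1_{\mathscr{C}}$, $\eta_M$ is a central element of $\Gamma_M$; regular means not a zero divisor. The category $\mathbf{HFact}_2(\mathscr{C},1_{\mathscr{C}},\eta)$. Objects are diagrams $M_1 \xrightarrow{f_1} M_2 \xrightarrow{f_2} M_1$ in $\mathscr{C}$ with $f_2 \circ f_1 = \eta_{M_1}$ and $f_1 \circ f_2 = \eta_{M_2}$. A morphism of diagrams from $(M_i,f_i)$ to $(N_i,g_i)$ is a pair $\varphi = (\varphi_1,\varphi_2)$, $\varphi_i \colon M_i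 \to N_i$, with $\varphi_2 \circ f_1 = g_1 \circ \varphi_1$ and $\varphi_1 \circ f_2 = g_2 \circ \varphi_2$. Two such $\varphi,\varphi'$ are homotopic if there are $s_1 \colon M_2 \to N_1$ and $s_2 \colon M_1 \to N_2$ in $\mathscr{C}$ with $\varphi_1 - \varphi_1' = s_1 \circ f_1 + g_2 \circ s_2$ and $\varphi_2 - \varphi_2' = s_2 \circ f_2 + g_1 \circ s_1$. Morphisms in $\mathbf{HFact}_2(\mathscr{C},1_{\mathscr{C}},\eta)$ are the homotopy classes $[\varphi]$. The suspension is $\Sigma(M_1 \xrightarrow{f_1} M_2 \xrightarrow{f_2} M_1) = (M_2 \xrightarrow{-f_2} M_1 \xrightarrow{-f_1} M_2)$, $\Sigma(\varphi_1,\varphi_2) = (\varphi_2,\varphi_1)$. The mapping cone $C_\varphi$ is $M_2 \oplus N_1 \to M_1 \oplus N_2 \to M_2 \oplus N_1$ with maps $\left[\begin{smallmatrix} -f_2 & 0 \\ \varphi_2 & g_1 \end{smallmatrix}\right]$ and $\left[\begin{smallmatrix} -f_1 & 0 \\ \varphi_1 & g_2 \end{smallmatrix}\right]$. A standard triangle is $(M_i,f_i) \xrightarrow{[\varphi]} (N_i,g_i) \xrightarrow{[i_\varphi]} C_\varphi \xrightarrow{[\pi_\varphi]} \Sigma(M_i,f_i)$, where $i_\varphi$ and $\pi_\varphi$ have all components $\left[\begin{smallmatrix} 0 \\ 1 \end{smallmatrix}\right]$ and $\left[\begin{smallmatrix} 1 & 0 \end{smallmatrix}\right]$, respectively. $\Delta$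 is the collection of all triangles isomorphic to a standard triangle. With this structure the category is triangulated. The category $\mathbf{K_{tac}}\,\mathscr{P}(\Gamma)$. For a ring $\Gamma$, $\mathscr{P}(\Gamma)$ denotes the category of finitely generated projective right $\Gamma$-modules. A complex $C$ of right $\Gamma$-modules is totally acyclic if both $C$ and $\operatorname{Hom}_\Gamma(C,\Gamma)$ are acyclic (exact). $\mathbf{K_{tac}}\,\mathscr{P}(\Gamma)$ is the homotopy category of totally acyclic complexes of modules in $\mathscr{P}(\Gamma)$, with the usual triangulated structure of the homotopy category of complexes. The functor. It sends an object $X \xrightarrow{f} Y \xrightarrow{g} X$ to the $2$-periodic complex $\cdots \to \overline{e}(X) \xrightarrow{\overline{f_*}} \overline{e}(Y) \xrightarrow{\overline{g_*}} \overline{e}(X) \xrightarrow{\overline{f_*}} \overline{e}(Y) \to \cdots$, where $\overline{e}(X) = \operatorname{Hom}_{\mathscr{C}}(M,X)/\operatorname{Hom}_{\mathscr{C}}(M,X)\cdot\eta_M$ (with $\overline{e}(X)$ in even degrees), $f_*(w) = f \circ w$, and overlines denote induced maps; the class of a morphism of factorizations is sent to the class of the induced $2$-periodic chain map. $\operatorname{Hom}_{\mathscr{C}}(M,X)$ is a right $\Gamma_M$-module by precomposition. Under the stated hypotheses this complex is totally acyclic and this assignment is a well-defined triangle functor. *)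

(* Defs.v *)
From HB Require Import structures.
From mathcomp Require Import all_boot all_algebra.
From mathcomp Require Import boolp classical_sets.

Set Implicit Arguments.
Unset Strict Implicit.
Unset Printing Implicit Defensive.

Import GRing.Theory.
Local Open Scope ring_scope.
Local Open Scope quotient_scope.

Record subgroup (V : zmodType) := Subgroup {
  sub_mem :> V -> Prop;
  sub_mem0 : sub_mem 0;
  sub_memB : forall x y, sub_mem x -> sub_mem y -> sub_mem (x - y) }.

Definition sub_pred (V : zmodType) (S : subgroup V) : V -> bool :=
  fun x => `[< S x >].

Lemma sub_pred_closed (V : zmodType) (S : subgroup V) :
  zmod_closed (sub_pred S).
Proof.
split; first exact/asboolP/sub_mem0.
by move=> x y /asboolP Sx /asboolP Sy; apply/asboolP/sub_memB.
Qed.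

HB.instance Definition _ (V : zmodType) (S : subgroup V) :=
  GRing.isZmodClosed.Build V (sub_pred S) (sub_pred_closed S).

Definition sub_zmod (V : zmodType) (S : subgroup V) : zmodClosed V :=
  GRing.ZmodClosed.clone V (sub_pred S) _.

Definition zquot (V : zmodType) (S : subgroup V) : zmodType :=
  Quotient.quot (sub_zmod S).

Definition zpi (V : zmodType) (S : subgroup V) : V -> zquot S :=
  \pi_(Quotient.quot (sub_zmod S)).

Definition zrepr (V : zmodType) (S : subgroup V) (q : zquot S) : V :=
  repr (q : Quotient.quot (sub_zmod S)).

Section ZQuotTheory.
Context (V : zmodType) (S : subgroup V).

Lemma zreprK (q : zquot S) : zpi S (zrepr q) = q.
Proof. exact: reprK. Qed.

Lemma zpiP (q : zquot S) : exists x, q = zpi S x.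
Proof. by exists (zrepr q); rewrite zreprK. Qed.

Lemma eq_zpi (x y : V) : zpi S x = zpi S y <-> S (x - y).
Proof.
split => [/eqP|Sxy]; first by rewrite /zpi -Quotient.idealrBE => /asboolP.
by apply/eqP; rewrite /zpi -Quotient.idealrBE; apply/asboolP.
Qed.

Lemma zpi_is_zmod_morphism : zmod_morphism (zpi S).
Proof. by move=> x y; rewrite /zpi !piE. Qed.

HB.instance Definition _ :=
  GRing.isZmodMorphism.Build V (zquot S) (zpi S) zpi_is_zmod_morphism.

Lemma zpi_eq0 (x : V) : zpi S x = 0 <-> S x.
Proof. by rewrite -(raddf0 (zpi S)) eq_zpi subr0. Qed.

Lemma zrepr_zpi (x : V) : S (zrepr (zpi S x) - x).
Proof. by apply/eq_zpi; rewrite zreprK. Qed.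

End ZQuotTheory.

Record preaddCat := PreaddCat {
  obj :> Type;
  hom : obj -> obj -> zmodType;
  idm : forall X, hom X X;
  mcomp : forall X Y Z, hom Y Z -> hom X Y -> hom X Z;
  compA : forall W X Y Z (h : hom Y Z) (g : hom X Y) (f : hom W X),
    mcomp h (mcomp g f) = mcomp (mcomp h g) f;
  comp1m : forall X Y (f : hom X Y), mcomp (idm Y) f = f;
  compm1 : forall X Y (f : hom X Y), mcomp f (idm X) = f;
  compDl : forall X Y Z (g g' : hom Y Z) (f : hom X Y),
    mcomp (g + g') f = mcomp g f + mcomp g' f;
  compDr : forall X Y Z (g : hom Y Z) (f f' : hom X Y),
    mcomp g (f + f') = mcomp g f + mcomp g f' }.

Arguments idm {_} X.
Arguments mcomp {_ X Y Z}.


Reserved Notation "g ∘ f" (at level 40, left associativity).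
Notation "g ∘ f" := (mcomp g f) : ring_scope.

Section PreaddTheory.
Context (A : preaddCat).
Implicit Types X Y Z : A.

Lemma comp0m X Y Z (f : hom X Y) : (0 : hom Y Z) ∘ f = 0.
Proof. by apply: (addrI (0 ∘ f)); rewrite -compDl !addr0. Qed.

Lemma compm0 X Y Z (g : hom Y Z) : g ∘ (0 : hom X Y) = 0.
Proof. by apply: (addrI (g ∘ 0)); rewrite -compDr !addr0. Qed.

Lemma compNm X Y Z (g : hom Y Z) (f : hom X Y) : (- g) ∘ f = - (g ∘ f).
Proof. by apply: (addrI (g ∘ f)); rewrite -compDl !subrr comp0m. Qed.

Lemma compmN X Y Z (g : hom Y Z) (f : hom X Y) : g ∘ (- f) = - (g ∘ f).
Proof. by apply: (addrI (g ∘ f)); rewrite -compDr !subrr compm0. Qed.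

Lemma compBl X Y Z (g g' : hom Y Z) (f : hom X Y) :
  (g - g') ∘ f = g ∘ f - g' ∘ f.
Proof. by rewrite compDl compNm. Qed.

Lemma compBr X Y Z (g : hom Y Z) (f f' : hom X Y) :
  g ∘ (f - f') = g ∘ f - g ∘ f'.
Proof. by rewrite compDr compmN. Qed.

End PreaddTheory.

Definition is_iso (A : preaddCat) (X Y : A) (f : hom X Y) : Prop :=
  exists g : hom Y X, g ∘ f = idm X /\ f ∘ g = idm Y.

Record addCat := AddCat {
  acat :> preaddCat;
  zobj : acat;
  to_zobj : forall (X : acat) (f : hom X zobj), f = 0;
  of_zobj : forall (X : acat) (f : hom zobj X), f = 0;
  bip : acat -> acat -> acat;
  inj1 : forall X Y, hom X (bip X Y);
  inj2 : forall X Y, hom Y (bip X Y);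
  prj1 : forall X Y, hom (bip X Y) X;
  prj2 : forall X Y, hom (bip X Y) Y;
  prj1_inj1 : forall X Y, prj1 X Y ∘ inj1 X Y = idm X;
  prj2_inj2 : forall X Y, prj2 X Y ∘ inj2 X Y = idm Y;
  prj1_inj2 : forall X Y, prj1 X Y ∘ inj2 X Y = 0;
  prj2_inj1 : forall X Y, prj2 X Y ∘ inj1 X Y = 0;
  bip_id : forall X Y,
    inj1 X Y ∘ prj1 X Y + inj2 X Y ∘ prj2 X Y = idm (bip X Y) }.

Arguments inj1 {_ X Y}.
Arguments inj2 {_ X Y}.
Arguments prj1 {_ X Y}.
Arguments prj2 {_ X Y}.

(** [bip_mx a b c d] has matrix [[a, b], [c, d]] acting on columns. *)
Definition bip_mx (C : addCat) (X1 X2 Y1 Y2 : C)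
    (a : hom X1 Y1) (b : hom X2 Y1) (c : hom X1 Y2) (d : hom X2 Y2) :
    hom (bip X1 X2) (bip Y1 Y2) :=
  inj1 ∘ (a ∘ prj1 + b ∘ prj2) + inj2 ∘ (c ∘ prj1 + d ∘ prj2).

Fixpoint copies (C : addCat) (M : C) (n : nat) : C :=
  if n is n'.+1 then bip M (copies M n') else zobj C.

Definition in_add (C : addCat) (M X : C) : Prop :=
  exists n : nat, (0 < n)%N /\
    exists (i : hom X (copies M n)) (p : hom (copies M n) X), p ∘ i = idm X.

Record functor (A B : preaddCat) := Functor {
  fobj :> A -> B;
  fmap : forall X Y, hom X Y -> hom (fobj X) (fobj Y);
  fmap1 : forall X, fmap (idm X) = idm (fobj X);
  fmapM : forall X Y Z (g : hom Y Z) (f : hom X Y),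
    fmap (g ∘ f) = fmap g ∘ fmap f }.

Arguments fmap {A B} F {X Y} : rename.

Definition additive_functor (A B : preaddCat) (F : functor A B) : Prop :=
  forall (X Y : A) (f g : hom X Y), fmap F (f + g) = fmap F f + fmap F g.

Definition idF (A : preaddCat) : functor A A :=
  @Functor A A (fun X => X) (fun X Y f => f)
    (fun X => erefl) (fun X Y Z g f => erefl).

Lemma compF_1 (A B D : preaddCat) (G : functor B D) (F : functor A B) (X : A) :
  fmap G (fmap F (idm X)) = idm (G (F X)).
Proof. by rewrite !fmap1. Qed.

Lemma compF_M (A B D : preaddCat) (G : functor B D) (F : functor A B)
    (X Y Z : A) (g : hom Y Z) (f : hom X Y) :
  fmap G (fmap F (g ∘ f)) = fmap G (fmap F g) ∘ fmap G (fmap F f).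
Proof. by rewrite !fmapM. Qed.

Definition compF (A B D : preaddCat) (G : functor B D) (F : functor A B) :
    functor A D :=
  @Functor A D (fun X => G (F X)) (fun X Y f => fmap G (fmap F f))
    (compF_1 G F) (compF_M G F).

Record nat_trans (A B : preaddCat) (F G : functor A B) := NatTrans {
  ntc :> forall X : A, hom (F X) (G X);
  ntcE : forall (X Y : A) (f : hom X Y), ntc Y ∘ fmap F f = fmap G f ∘ ntc X }.

Definition nat_iso (A B : preaddCat) (F G : functor A B) (a : nat_trans F G) :
  Prop := forall X, is_iso (a X).

Definition is_equivalence (A B : preaddCat) (F : functor A B) : Prop :=
  exists (G : functor B A)
         (a : nat_trans (compF G F) (idF A)) (b : nat_trans (compF F G) (idF B)),
    nat_iso a /\ nat_iso b.

Record hom_ideal (A : preaddCat) := HomIdeal {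
  hideal :> forall X Y : A, subgroup (hom X Y);
  hidealMl : forall X Y Z (g : hom Y Z) (f : hom X Y),
    hideal X Y f -> hideal X Z (g ∘ f);
  hidealMr : forall X Y Z (g : hom Y Z) (f : hom X Y),
    hideal Y Z g -> hideal X Z (g ∘ f) }.

Section QuotCat.
Context (A : preaddCat) (I : hom_ideal A).

Definition qhom (X Y : A) : zmodType := zquot (I X Y).
Definition qpi (X Y : A) (f : hom X Y) : qhom X Y := zpi (I X Y) f.
Definition qcomp (X Y Z : A) (g : qhom Y Z) (f : qhom X Y) : qhom X Z :=
  qpi (zrepr g ∘ zrepr f).

Lemma qcomp_pi (X Y Z : A) (g : hom Y Z) (f : hom X Y) :
  qcomp (qpi g) (qpi f) = qpi (g ∘ f).
Proof.
apply/eq_zpi; set g' := zrepr _; set f' := zrepr _.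
have -> : g' ∘ f' - g ∘ f = g' ∘ (f' - f) - ((- (g' - g)) ∘ f).
  by rewrite compBr compNm compBl opprK addrA subrK.
apply: sub_memB; first by apply: hidealMl; apply: zrepr_zpi.
apply: hidealMr; rewrite -[- _]add0r; apply: sub_memB; first exact: sub_mem0.
exact: zrepr_zpi.
Qed.

Lemma qcompA (W X Y Z : A) (h : qhom Y Z) (g : qhom X Y) (f : qhom W X) :
  qcomp h (qcomp g f) = qcomp (qcomp h g) f.
Proof.
have [h' ->] := zpiP h; have [g' ->] := zpiP g; have [f' ->] := zpiP f.
by rewrite -!/(qpi _) !qcomp_pi compA.
Qed.

Lemma qcomp1m (X Y : A) (f : qhom X Y) : qcomp (qpi (idm Y)) f = f.
Proof. by have [f' ->] := zpiP f; rewrite -!/(qpi _) qcomp_pi comp1m. Qed.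

Lemma qcompm1 (X Y : A) (f : qhom X Y) : qcomp f (qpi (idm X)) = f.
Proof. by have [f' ->] := zpiP f; rewrite -!/(qpi _) qcomp_pi compm1. Qed.

Lemma qpiD (X Y : A) (f g : hom X Y) : qpi (f + g) = qpi f + qpi g.
Proof. exact: raddfD. Qed.

Lemma qcompDl (X Y Z : A) (g g' : qhom Y Z) (f : qhom X Y) :
  qcomp (g + g') f = qcomp g f + qcomp g' f.
Proof.
have [f1 ->] := zpiP f; have [g1 ->] := zpiP g; have [g2 ->] := zpiP g'.
by rewrite -!/(qpi _) -qpiD !qcomp_pi compDl qpiD.
Qed.

Lemma qcompDr (X Y Z : A) (g : qhom Y Z) (f f' : qhom X Y) :
  qcomp g (f + f') = qcomp g f + qcomp g f'.
Proof.
have [g1 ->] := zpiP g; have [f1 ->] := zpiP f; have [f2 ->] := zpiP f'.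
by rewrite -!/(qpi _) -qpiD !qcomp_pi compDr qpiD.
Qed.

Definition quot_cat : preaddCat :=
  @PreaddCat A qhom (fun X => qpi (idm X)) qcomp
    qcompA qcomp1m qcompm1 qcompDl qcompDr.

Definition cls (X Y : A) (f : hom X Y) : @hom quot_cat X Y := qpi f.

Lemma eq_cls (X Y : A) (f g : hom X Y) : cls f = cls g <-> I X Y (f - g).
Proof. exact: eq_zpi. Qed.

Lemma cls_comp (X Y Z : A) (g : hom Y Z) (f : hom X Y) :
  cls (g ∘ f) = cls g ∘ cls f.
Proof. by rewrite /cls -qcomp_pi. Qed.

Lemma clsD (X Y : A) (f g : hom X Y) : cls (f + g) = cls f + cls g.
Proof. exact: qpiD. Qed.

Lemma clsP (X Y : A) (q : @hom quot_cat X Y) : exists f, q = cls f.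
Proof. exact: zpiP. Qed.

End QuotCat.

Section QuotFunctor.
Context (A B : preaddCat) (I : hom_ideal A) (J : hom_ideal B).
Context (F : functor A B) (FD : additive_functor F).
Context (FI : forall X Y (f : hom X Y), I X Y f -> J _ _ (fmap F f)).

Definition qmap (X Y : A) (f : @hom (quot_cat I) X Y) :
    @hom (quot_cat J) (F X) (F Y) := cls J (fmap F (zrepr f)).

Lemma qmap_cls (X Y : A) (f : hom X Y) : qmap (cls I f) = cls J (fmap F f).
Proof.
have FB (g h : hom X Y) : fmap F (g - h) = fmap F g - fmap F h.
  by apply: (addIr (fmap F h)); rewrite -FD !subrK.
by apply/eq_cls; rewrite -FB; apply: FI; apply: zrepr_zpi.
Qed.

Lemma qmap1 (X : A) : qmap (@idm (quot_cat I) X) = idm _.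
Proof. by rewrite [LHS]qmap_cls fmap1. Qed.

Lemma qmapM (X Y Z : quot_cat I) (g : hom Y Z) (f : hom X Y) :
  qmap (g ∘ f) = qmap g ∘ qmap f.
Proof.
have [g' ->] := clsP g; have [f' ->] := clsP f.
by rewrite -cls_comp !qmap_cls fmapM cls_comp.
Qed.

Definition quot_functor : functor (quot_cat I) (quot_cat J) :=
  @Functor (quot_cat I) (quot_cat J) F qmap qmap1 qmapM.

Lemma quot_functorD : additive_functor quot_functor.
Proof.
move=> X Y f g; have [f' ->] := clsP f; have [g' ->] := clsP g.
by rewrite -clsD /= !qmap_cls FD clsD.
Qed.

End QuotFunctor.

Section FullSub.
Context (A : preaddCat) (P : A -> Prop).

Record sub_obj := SubObj { sobj :> A; sobjP : P sobj }.

Definition full_sub : preaddCat :=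
  @PreaddCat sub_obj (fun X Y => hom X Y) (fun X => idm (sobj X))
    (fun X Y Z g f => g ∘ f)
    (fun W X Y Z h g f => compA h g f) (fun X Y f => comp1m f)
    (fun X Y f => compm1 f) (fun X Y Z g g' f => compDl g g' f)
    (fun X Y Z g f f' => compDr g f f').

Definition incl : functor full_sub A :=
  @Functor full_sub A sobj (fun X Y f => f)
    (fun X => erefl) (fun X Y Z g f => erefl).

Definition corestrict (B : preaddCat) (F : functor B A)
    (FP : forall X, P (F X)) : functor B full_sub :=
  @Functor B full_sub (fun X => SubObj (FP X)) (fun X Y f => fmap F f)
    (fmap1 F) (fmapM F).

End FullSub.

Record triangle (A : preaddCat) (S : functor A A) := Triangle {
  tri1 : A; tri2 : A; tri3 : A;
  tri_u : hom tri1 tri2;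
  tri_v : hom tri2 tri3;
  tri_w : hom tri3 (S tri1) }.

Arguments Triangle {A} S {tri1 tri2 tri3}.

Definition tri_iso (A : preaddCat) (S : functor A A) (T T' : triangle S) :=
  exists (a : hom (tri1 T) (tri1 T')) (b : hom (tri2 T) (tri2 T'))
         (c : hom (tri3 T) (tri3 T')),
    [/\ is_iso a, is_iso b & is_iso c] /\
    [/\ b ∘ tri_u T = tri_u T' ∘ a,
        c ∘ tri_v T = tri_v T' ∘ b
      & fmap S a ∘ tri_w T = tri_w T' ∘ c].

(** The data (category, suspension, distinguished triangles) of a triangulated
    category; the axioms are theorems about the two instances below and are not
    bundled. *)
Record triCat := TriCat {
  tcat :> preaddCat;
  susp : functor tcat tcat;
  dist : triangle susp -> Prop }.

Definition tri_map (A B : preaddCat) (S : functor A A) (S' : functor B B)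
    (F : functor A B) (t : nat_trans (compF F S) (compF S' F)) (T : triangle S) :
    triangle S' :=
  @Triangle B S' (F (tri1 T)) (F (tri2 T)) (F (tri3 T))
    (fmap F (tri_u T)) (fmap F (tri_v T)) (t (tri1 T) ∘ fmap F (tri_w T)).

Record tri_functor (A B : triCat) := TriFunctor {
  tfun :> functor A B;
  tfun_additive : additive_functor tfun;
  tfun_susp : nat_trans (compF tfun (susp A)) (compF (susp B) tfun);
  tfun_susp_iso : nat_iso tfun_susp;
  tfun_dist : forall T : triangle (susp A), dist T -> dist (tri_map tfun_susp T) }.

Lemma is_iso_id (A : preaddCat) (X : A) : is_iso (idm X).
Proof. by exists (idm X); rewrite comp1m. Qed.

Lemma is_iso_comp (A : preaddCat) (X Y Z : A) (g : hom Y Z) (f : hom X Y) :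
  is_iso g -> is_iso f -> is_iso (g ∘ f).
Proof.
move=> [g' [g1 g2]] [f' [f1 f2]]; exists (f' ∘ g').
by split; rewrite compA -(compA _ _ _) ?g1 ?f2 ?compm1 // -?compA;
  rewrite ?(compA g') ?g1 ?comp1m ?(compA f) ?f2 ?comp1m.
Qed.

Lemma is_iso_fmap (A B : preaddCat) (F : functor A B) (X Y : A) (f : hom X Y) :
  is_iso f -> is_iso (fmap F f).
Proof. by move=> [g [e1 e2]]; exists (fmap F g); rewrite -!fmapM e1 e2 !fmap1. Qed.

Lemma tri_iso_trans (A : preaddCat) (S : functor A A) (T T' T'' : triangle S) :
  tri_iso T T' -> tri_iso T' T'' -> tri_iso T T''.
Proof.
move=> [a [b [c [[ia ib ic] [e1 e2 e3]]]]] [a' [b' [c' [[ia' ib' ic'] [e1' e2' e3']]]]].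
exists (a' ∘ a), (b' ∘ b), (c' ∘ c); split; first by split; apply: is_iso_comp.
by split; rewrite ?fmapM -compA ?e1 ?e2 ?e3 compA ?e1' ?e2' ?e3' compA.
Qed.

Lemma tri_iso_map (A B : preaddCat) (S : functor A A) (S' : functor B B)
    (F : functor A B) (t : nat_trans (compF F S) (compF S' F)) (T T' : triangle S) :
  tri_iso T T' -> tri_iso (tri_map t T) (tri_map t T').
Proof.
move=> [a [b [c [[ia ib ic] [e1 e2 e3]]]]].
exists (fmap F a), (fmap F b), (fmap F c); split.
  by split; apply: is_iso_fmap.
split=> /=; rewrite -?fmapM ?e1 ?e2 //.
rewrite compA; have /= <- := ntcE t a.
by rewrite -!compA -!fmapM e3.
Qed.

Section BipTheory.
Context (C : addCat).

Lemma bip_mxM (X1 X2 Y1 Y2 Z1 Z2 : C)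
    (a' : hom Y1 Z1) (b' : hom Y2 Z1) (c' : hom Y1 Z2) (d' : hom Y2 Z2)
    (a : hom X1 Y1) (b : hom X2 Y1) (c : hom X1 Y2) (d : hom X2 Y2) :
  bip_mx a' b' c' d' ∘ bip_mx a b c d =
  bip_mx (a' ∘ a + b' ∘ c) (a' ∘ b + b' ∘ d)
         (c' ∘ a + d' ∘ c) (c' ∘ b + d' ∘ d).
Proof.
set R := bip_mx a b c d.
have p1 : prj1 ∘ R = a ∘ prj1 + b ∘ prj2.
  by rewrite /R /bip_mx compDr !compA prj1_inj1 prj1_inj2 comp1m comp0m addr0.
have p2 : prj2 ∘ R = c ∘ prj1 + d ∘ prj2.
  by rewrite /R /bip_mx compDr !compA prj2_inj1 prj2_inj2 comp1m comp0m add0r.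
rewrite {1}/bip_mx compDl -!compA !compDl -!compA p1 p2 /bip_mx.
rewrite !(compDl, compDr) !compA.
congr (_ + _); rewrite -!addrA; congr (_ + _);
  rewrite addrA [X in X + _]addrC -!addrA //.
all: by congr (_ + _).
Qed.

Lemma prj1_mx (X1 X2 Y1 Y2 : C)
    (a : hom X1 Y1) (b : hom X2 Y1) (c : hom X1 Y2) (d : hom X2 Y2) :
  prj1 ∘ bip_mx a b c d = a ∘ prj1 + b ∘ prj2.
Proof.
by rewrite /bip_mx compDr !compA prj1_inj1 prj1_inj2 comp1m comp0m addr0.
Qed.

Lemma prj2_mx (X1 X2 Y1 Y2 : C)
    (a : hom X1 Y1) (b : hom X2 Y1) (c : hom X1 Y2) (d : hom X2 Y2) :
  prj2 ∘ bip_mx a b c d = c ∘ prj1 + d ∘ prj2.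
Proof.
by rewrite /bip_mx compDr !compA prj2_inj1 prj2_inj2 comp1m comp0m add0r.
Qed.

Lemma mx_inj2 (X1 X2 Y1 Y2 : C)
    (a : hom X1 Y1) (b : hom X2 Y1) (c : hom X1 Y2) (d : hom X2 Y2) :
  bip_mx a b c d ∘ inj2 = inj1 ∘ b + inj2 ∘ d.
Proof.
rewrite /bip_mx !(compDl, compDr) -!compA prj1_inj2 prj2_inj2 !compm1.
by rewrite !compm0 !add0r.
Qed.

Lemma bip_mx_nat (t : nat_trans (idF C) (idF C)) (X Y : C) :
  bip_mx (t X : hom X X) 0 0 (t Y : hom Y Y) = t (bip X Y).
Proof.
rewrite /bip_mx !comp0m addr0 add0r.
have e1 := ntcE t (@prj1 C X Y); have e2 := ntcE t (@prj2 C X Y).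
rewrite /= in e1 e2; rewrite e1 e2 !compA -compDl.
by rewrite bip_id comp1m.
Qed.

End BipTheory.

Section HFact.
Context (C : addCat) (eta : nat_trans (idF C) (idF C)).

Record fact := Fact {
  fac1 : C;
  fac2 : C;
  fac_f1 : hom fac1 fac2;
  fac_f2 : hom fac2 fac1;
  fac_f2f1 : fac_f2 ∘ fac_f1 = eta fac1;
  fac_f1f2 : fac_f1 ∘ fac_f2 = eta fac2 }.

Definition fact_hom_pred (M N : fact) :
    hom (fac1 M) (fac1 N) * hom (fac2 M) (fac2 N) -> bool :=
  fun phi => (phi.2 ∘ fac_f1 M == fac_f1 N ∘ phi.1)
          && (phi.1 ∘ fac_f2 M == fac_f2 N ∘ phi.2).

Lemma fact_hom_closed (M N : fact) : zmod_closed (@fact_hom_pred M N).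
Proof.
split=> [|x y]; rewrite !unfold_in /=; first by rewrite !(comp0m, compm0) !eqxx.
move=> /andP[/eqP x1 /eqP x2] /andP[/eqP y1 /eqP y2].
by rewrite !(compBl, compBr) x1 x2 y1 y2 !eqxx.
Qed.

HB.instance Definition _ (M N : fact) :=
  GRing.isZmodClosed.Build _ (@fact_hom_pred M N) (fact_hom_closed M N).

Record fact_hom (M N : fact) := FactHom {
  fact_val :> hom (fac1 M) (fac1 N) * hom (fac2 M) (fac2 N);
  fact_valP : fact_val \in @fact_hom_pred M N }.

HB.instance Definition _ (M N : fact) := [isSub for @fact_val M N].
HB.instance Definition _ (M N : fact) := [Choice of fact_hom M N by <:].
HB.instance Definition _ (M N : fact) :=
  [SubChoice_isSubZmodule of fact_hom M N by <:].

Lemma fact_homE1 (M N : fact) (phi : fact_hom M N) :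
  phi.2 ∘ fac_f1 M = fac_f1 N ∘ phi.1.
Proof. by have /andP[/eqP] := fact_valP phi. Qed.

Lemma fact_homE2 (M N : fact) (phi : fact_hom M N) :
  phi.1 ∘ fac_f2 M = fac_f2 N ∘ phi.2.
Proof. by have /andP[_ /eqP] := fact_valP phi. Qed.

Lemma fact_homP (M N : fact) (phi1 : hom (fac1 M) (fac1 N))
    (phi2 : hom (fac2 M) (fac2 N)) :
  phi2 ∘ fac_f1 M = fac_f1 N ∘ phi1 -> phi1 ∘ fac_f2 M = fac_f2 N ∘ phi2 ->
  (phi1, phi2) \in @fact_hom_pred M N.
Proof. by move=> e1 e2; rewrite unfold_in /= e1 e2 !eqxx. Qed.

Definition mk_fact_hom (M N : fact) (phi1 : hom (fac1 M) (fac1 N))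
    (phi2 : hom (fac2 M) (fac2 N))
    (e1 : phi2 ∘ fac_f1 M = fac_f1 N ∘ phi1)
    (e2 : phi1 ∘ fac_f2 M = fac_f2 N ∘ phi2) : fact_hom M N :=
  FactHom (fact_homP e1 e2).

Lemma fact_hom_ext (M N : fact) (phi psi : fact_hom M N) :
  phi.1 = psi.1 -> phi.2 = psi.2 -> phi = psi.
Proof.
move=> e1 e2; apply: val_inj; rewrite /=.
by rewrite [LHS]surjective_pairing [RHS]surjective_pairing e1 e2.
Qed.

Definition fact_id (M : fact) : fact_hom M M :=
  @mk_fact_hom M M (idm _) (idm _)
    (etrans (comp1m _) (esym (compm1 _))) (etrans (comp1m _) (esym (compm1 _))).

Lemma fact_comp_subproof1 (M N P : fact) (psi : fact_hom N P)
    (phi : fact_hom M N) :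
  (psi.2 ∘ phi.2) ∘ fac_f1 M = fac_f1 P ∘ (psi.1 ∘ phi.1).
Proof. by rewrite -compA fact_homE1 compA fact_homE1 compA. Qed.

Lemma fact_comp_subproof2 (M N P : fact) (psi : fact_hom N P)
    (phi : fact_hom M N) :
  (psi.1 ∘ phi.1) ∘ fac_f2 M = fac_f2 P ∘ (psi.2 ∘ phi.2).
Proof. by rewrite -compA fact_homE2 compA fact_homE2 compA. Qed.

Definition fact_comp (M N P : fact) (psi : fact_hom N P) (phi : fact_hom M N) :
    fact_hom M P :=
  mk_fact_hom (fact_comp_subproof1 psi phi) (fact_comp_subproof2 psi phi).

Lemma fact_compA (M N P Q : fact) (h : fact_hom P Q) (g : fact_hom N P)
    (f : fact_hom M N) :
  fact_comp h (fact_comp g f) = fact_comp (fact_comp h g) f.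
Proof. by apply: fact_hom_ext => /=; rewrite compA. Qed.

Lemma fact_comp1m (M N : fact) (f : fact_hom M N) : fact_comp (fact_id N) f = f.
Proof. by apply: fact_hom_ext => /=; rewrite comp1m. Qed.

Lemma fact_compm1 (M N : fact) (f : fact_hom M N) : fact_comp f (fact_id M) = f.
Proof. by apply: fact_hom_ext => /=; rewrite compm1. Qed.

Lemma fact_compDl (M N P : fact) (g g' : fact_hom N P) (f : fact_hom M N) :
  fact_comp (g + g') f = fact_comp g f + fact_comp g' f.
Proof. by apply: fact_hom_ext => /=; rewrite compDl. Qed.

Lemma fact_compDr (M N P : fact) (g : fact_hom N P) (f f' : fact_hom M N) :
  fact_comp g (f + f') = fact_comp g f + fact_comp g f'.
Proof. by apply: fact_hom_ext => /=; rewrite compDr. Qed.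

Definition fact_cat : preaddCat :=
  @PreaddCat fact (fun M N => fact_hom M N) fact_id fact_comp
    fact_compA fact_comp1m fact_compm1 fact_compDl fact_compDr.

Definition fact_null (M N : fact) (phi : fact_hom M N) : Prop :=
  exists (s1 : hom (fac2 M) (fac1 N)) (s2 : hom (fac1 M) (fac2 N)),
    phi.1 = s1 ∘ fac_f1 M + fac_f2 N ∘ s2 /\
    phi.2 = s2 ∘ fac_f2 M + fac_f1 N ∘ s1.

Lemma fact_null0 (M N : fact) : fact_null (0 : fact_hom M N).
Proof. by exists 0, 0; rewrite !(comp0m, compm0) !addr0. Qed.

Lemma fact_nullB (M N : fact) (phi psi : fact_hom M N) :
  fact_null phi -> fact_null psi -> fact_null (phi - psi).
Proof.
move=> [s1 [s2 [e1 e2]]] [t1 [t2 [e3 e4]]]; exists (s1 - t1), (s2 - t2).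
by rewrite /= e1 e2 e3 e4 !(compBl, compBr) !opprD; split; rewrite addrACA.
Qed.

Lemma fact_nullMl (M N P : fact) (psi : fact_hom N P) (phi : fact_hom M N) :
  fact_null phi -> fact_null (fact_comp psi phi).
Proof.
move=> [s1 [s2 [e1 e2]]]; exists (psi.1 ∘ s1), (psi.2 ∘ s2).
rewrite /= e1 e2 !compDr !compA.
by split; rewrite ?fact_homE1 ?fact_homE2.
Qed.

Lemma fact_nullMr (M N P : fact) (psi : fact_hom N P) (phi : fact_hom M N) :
  fact_null psi -> fact_null (fact_comp psi phi).
Proof.
move=> [s1 [s2 [e1 e2]]]; exists (s1 ∘ phi.2), (s2 ∘ phi.1).
rewrite /= e1 e2 !compDl -!compA.
by split; rewrite ?fact_homE1 ?fact_homE2.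
Qed.

Definition fact_homotopy : hom_ideal fact_cat :=
  @HomIdeal fact_cat
    (fun M N => Subgroup (@fact_null0 M N) (@fact_nullB M N))
    fact_nullMl fact_nullMr.

Definition hfact_cat : preaddCat := quot_cat fact_homotopy.

Lemma fact_susp_subproof1 (M : fact) : (- fac_f1 M) ∘ (- fac_f2 M) = eta (fac2 M).
Proof. by rewrite compNm compmN opprK fac_f1f2. Qed.

Lemma fact_susp_subproof2 (M : fact) : (- fac_f2 M) ∘ (- fac_f1 M) = eta (fac1 M).
Proof. by rewrite compNm compmN opprK fac_f2f1. Qed.

Definition fact_susp_obj (M : fact) : fact :=
  Fact (fact_susp_subproof1 M) (fact_susp_subproof2 M).

Lemma fact_susp_map1 (M N : fact) (phi : fact_hom M N) :
  phi.1 ∘ (- fac_f2 M) = (- fac_f2 N) ∘ phi.2.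
Proof. by rewrite compmN compNm fact_homE2. Qed.

Lemma fact_susp_map2 (M N : fact) (phi : fact_hom M N) :
  phi.2 ∘ (- fac_f1 M) = (- fac_f1 N) ∘ phi.1.
Proof. by rewrite compmN compNm fact_homE1. Qed.

Definition fact_susp_map (M N : fact) (phi : fact_hom M N) :
    fact_hom (fact_susp_obj M) (fact_susp_obj N) :=
  @mk_fact_hom (fact_susp_obj M) (fact_susp_obj N) phi.2 phi.1
    (fact_susp_map1 phi) (fact_susp_map2 phi).

Lemma fact_susp_1 (M : fact) : fact_susp_map (fact_id M) = fact_id _.
Proof. exact: fact_hom_ext. Qed.

Lemma fact_susp_M (M N P : fact) (psi : fact_hom N P) (phi : fact_hom M N) :
  fact_susp_map (fact_comp psi phi) =
  fact_comp (fact_susp_map psi) (fact_susp_map phi).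
Proof. exact: fact_hom_ext. Qed.

Definition fact_susp : functor fact_cat fact_cat :=
  @Functor fact_cat fact_cat fact_susp_obj fact_susp_map fact_susp_1 fact_susp_M.

Lemma fact_suspD : additive_functor fact_susp.
Proof. by move=> M N f g; apply: fact_hom_ext. Qed.

Lemma fact_susp_null (M N : fact_cat) (phi : hom M N) :
  fact_homotopy M N phi -> fact_homotopy _ _ (fmap fact_susp phi).
Proof.
move=> [s1 [s2 [e1 e2]]]; exists (- s2), (- s1) => /=.
by rewrite e1 e2 !(compNm, compmN) !opprK.
Qed.

Definition hfact_susp : functor hfact_cat hfact_cat :=
  quot_functor fact_suspD fact_susp_null.

Section Cone.
Context (M N : fact) (phi : fact_hom M N).

Definition fact_cone_f1 :
    hom (bip (fac2 M) (fac1 N)) (bip (fac1 M) (fac2 N)) :=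
  bip_mx (- fac_f2 M) 0 phi.2 (fac_f1 N).

Definition fact_cone_f2 :
    hom (bip (fac1 M) (fac2 N)) (bip (fac2 M) (fac1 N)) :=
  bip_mx (- fac_f1 M) 0 phi.1 (fac_f2 N).

Lemma fact_cone_subproof1 :
  fact_cone_f2 ∘ fact_cone_f1 = eta (bip (fac2 M) (fac1 N)).
Proof.
rewrite bip_mxM !(compNm, compmN, compm0, comp0m) opprK !(addr0, add0r, oppr0).
by rewrite fact_homE2 addNr fac_f1f2 fac_f2f1; apply: bip_mx_nat.
Qed.

Lemma fact_cone_subproof2 :
  fact_cone_f1 ∘ fact_cone_f2 = eta (bip (fac1 M) (fac2 N)).
Proof.
rewrite bip_mxM !(compNm, compmN, compm0, comp0m) opprK !(addr0, add0r, oppr0).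
by rewrite fact_homE1 addNr fac_f1f2 fac_f2f1; apply: bip_mx_nat.
Qed.

Definition fact_cone : fact := Fact fact_cone_subproof1 fact_cone_subproof2.

Lemma fact_cone_in1 : inj2 ∘ fac_f1 N = fac_f1 fact_cone ∘ inj2.
Proof. by rewrite /= mx_inj2 compm0 add0r. Qed.

Lemma fact_cone_in2 : inj2 ∘ fac_f2 N = fac_f2 fact_cone ∘ inj2.
Proof. by rewrite /= mx_inj2 compm0 add0r. Qed.

Definition fact_cone_in : fact_hom N fact_cone :=
  @mk_fact_hom N fact_cone inj2 inj2 fact_cone_in1 fact_cone_in2.

Lemma fact_cone_pr1 : prj1 ∘ fac_f1 fact_cone = (- fac_f2 M) ∘ prj1.
Proof. by rewrite /= prj1_mx comp0m addr0. Qed.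

Lemma fact_cone_pr2 : prj1 ∘ fac_f2 fact_cone = (- fac_f1 M) ∘ prj1.
Proof. by rewrite /= prj1_mx comp0m addr0. Qed.

Definition fact_cone_pr : fact_hom fact_cone (fact_susp_obj M) :=
  @mk_fact_hom fact_cone (fact_susp_obj M) prj1 prj1 fact_cone_pr1 fact_cone_pr2.

Definition fact_std_triangle : triangle hfact_susp :=
  @Triangle hfact_cat hfact_susp M N fact_cone
    (cls fact_homotopy (phi : @hom fact_cat M N))
    (cls fact_homotopy (fact_cone_in : @hom fact_cat N fact_cone))
    (cls fact_homotopy (fact_cone_pr : @hom fact_cat fact_cone (fact_susp M))).

End Cone.

Definition HFact : triCat :=
  @TriCat hfact_cat hfact_susp
    (fun T => exists (M N : fact) (phi : fact_hom M N),
       tri_iso T (fact_std_triangle phi)).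

End HFact.

(** Right [R]-modules are left modules over the converse ring [R^c]; the scalar
    action [a *: x] stands for [x a]. *)
Notation rmodType R := (lmodType R^c).

Section Modules.
Context (R : pzRingType).

Definition fin_gen (P : lmodType R) : Prop :=
  exists (n : nat) (x : 'I_n -> P),
    forall y : P, exists a : 'I_n -> R, y = \sum_(i < n) a i *: x i.

Definition projective (P : lmodType R) : Prop :=
  forall (A B : lmodType R) (p : {linear A -> B}) (f : {linear P -> B}),
    (forall b : B, exists a : A, p a = b) ->
    exists g : {linear P -> A}, forall x, p (g x) = f x.

Lemma linear_ext (U V : lmodType R) (f g : {linear U -> V}) : f =1 g -> f = g.
Proof.
case: f g => [f cf] [g cg] /= /funext fg; move: fg cf cg => -> cf cg.
congr GRing.Linear.Pack.
case: cf cg => [[m1] [s1]] [[m2] [s2]].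
by rewrite (Prop_irrelevance m1 m2) (Prop_irrelevance s1 s2).
Qed.

End Modules.

(** Cohomological indexing: [d i] goes from degree [i] to degree [i + 1]. *)
Record complex (R : pzRingType) := Complex {
  cpx :> int -> rmodType R;
  diff : forall i : int, {linear cpx i -> cpx (i + 1)};
  diffK : forall (i : int) (x : cpx i), diff (i + 1) (diff i x) = 0 }.

Arguments diff {R} C i : rename.

Record chain_map (R : pzRingType) (C D : complex R) := ChainMap {
  chm :> forall i : int, {linear C i -> D i};
  chmE : forall (i : int) (x : C i), chm (i + 1) (diff C i x) = diff D i (chm i x) }.

Section ChainMaps.
Context (R : pzRingType).
Implicit Types B C D E : complex R.

Lemma chm_ext C D (f g : chain_map C D) : (forall i x, f i x = g i x) -> f = g.
Proof.
case: f g => [f fE] [g gE] /= fg.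
have e : f = g.
  by apply: functional_extensionality_dep => i; apply: linear_ext => x; apply: fg.
by move: e fE gE => -> fE gE; congr ChainMap; apply: Prop_irrelevance.
Qed.

HB.instance Definition _ C D := gen_eqMixin (chain_map C D).
HB.instance Definition _ C D := gen_choiceMixin (chain_map C D).

Lemma chm_zero_subproof C D i (x : C i) :
  (\0 : {linear C (i + 1) -> D (i + 1)}) (diff C i x) = diff D i ((\0 : {linear C i -> D i}) x).
Proof. by rewrite /= linear0. Qed.

Definition chm_zero C D : chain_map C D := ChainMap (@chm_zero_subproof C D).

Lemma chm_opp_subproof C D (f : chain_map C D) i (x : C i) :
  (\- f (i + 1)) (diff C i x) = diff D i ((\- f i) x).
Proof. by rewrite /= chmE linearN. Qed.

Definition chm_opp C D (f : chain_map C D) : chain_map C D :=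
  @ChainMap R C D (fun i => (\- f i : {linear _ -> _})) (chm_opp_subproof f).

Lemma chm_add_subproof C D (f g : chain_map C D) i (x : C i) :
  (f (i + 1) \+ g (i + 1)) (diff C i x) = diff D i ((f i \+ g i) x).
Proof. by rewrite /= !chmE linearD. Qed.

Definition chm_add C D (f g : chain_map C D) : chain_map C D :=
  @ChainMap R C D (fun i => (f i \+ g i : {linear _ -> _})) (chm_add_subproof f g).

Lemma chm_addA C D : associative (@chm_add C D).
Proof. by move=> f g h; apply: chm_ext => i x /=; rewrite addrA. Qed.
Lemma chm_addC C D : commutative (@chm_add C D).
Proof. by move=> f g; apply: chm_ext => i x /=; rewrite addrC. Qed.
Lemma chm_add0 C D : left_id (chm_zero C D) (@chm_add C D).
Proof. by move=> f; apply: chm_ext => i x /=; rewrite add0r. Qed.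
Lemma chm_addN C D : left_inverse (chm_zero C D) (@chm_opp C D) (@chm_add C D).
Proof. by move=> f; apply: chm_ext => i x /=; rewrite addNr. Qed.

HB.instance Definition _ C D := GRing.isZmodule.Build (chain_map C D)
  (@chm_addA C D) (@chm_addC C D) (@chm_add0 C D) (@chm_addN C D).

Lemma chm0E C D i (x : C i) : (0 : chain_map C D) i x = 0.
Proof. by []. Qed.
Lemma chmDE C D (f g : chain_map C D) i (x : C i) : (f + g) i x = f i x + g i x.
Proof. by []. Qed.
Lemma chmNE C D (f : chain_map C D) i (x : C i) : (- f) i x = - f i x.
Proof. by []. Qed.

Lemma chm_id_subproof C i (x : C i) :
  (idfun : {linear C (i + 1) -> C (i + 1)}) (diff C i x) =
  diff C i ((idfun : {linear C i -> C i}) x).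
Proof. by []. Qed.

Definition chm_id C : chain_map C C := ChainMap (@chm_id_subproof C).

Lemma chm_comp_subproof C D E (g : chain_map D E) (f : chain_map C D) i (x : C i) :
  (g (i + 1) \o f (i + 1)) (diff C i x) = diff E i ((g i \o f i) x).
Proof. by rewrite /= !chmE. Qed.

Definition chm_comp C D E (g : chain_map D E) (f : chain_map C D) :
    chain_map C E :=
  @ChainMap R C E (fun i => (g i \o f i : {linear _ -> _}))
    (chm_comp_subproof g f).

Lemma chm_compA B C D E (h : chain_map D E) (g : chain_map C D)
    (f : chain_map B C) :
  chm_comp h (chm_comp g f) = chm_comp (chm_comp h g) f.
Proof. exact: chm_ext. Qed.
Lemma chm_comp1m C D (f : chain_map C D) : chm_comp (chm_id D) f = f.
Proof. exact: chm_ext. Qed.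
Lemma chm_compm1 C D (f : chain_map C D) : chm_comp f (chm_id C) = f.
Proof. exact: chm_ext. Qed.
Lemma chm_compDl C D E (g g' : chain_map D E) (f : chain_map C D) :
  chm_comp (g + g') f = chm_comp g f + chm_comp g' f.
Proof. exact: chm_ext. Qed.
Lemma chm_compDr C D E (g : chain_map D E) (f f' : chain_map C D) :
  chm_comp g (f + f') = chm_comp g f + chm_comp g f'.
Proof. by apply: chm_ext => i x /=; rewrite linearD. Qed.

Definition complex_cat : preaddCat :=
  @PreaddCat (complex R) (fun C D => chain_map C D) chm_id chm_comp
    chm_compA chm_comp1m chm_compm1 chm_compDl chm_compDr.

Definition chm_null C D (f : chain_map C D) : Prop :=
  exists s : forall i : int, {linear C (i + 1) -> D i},
    forall (i : int) (x : C (i + 1)),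
      f (i + 1) x = diff D i (s i x) + s (i + 1) (diff C (i + 1) x).

Lemma chm_null0 C D : chm_null (0 : chain_map C D).
Proof. by exists (fun i => \0) => i x; rewrite /= linear0 addr0. Qed.

Lemma chm_nullB C D (f g : chain_map C D) :
  chm_null f -> chm_null g -> chm_null (f - g).
Proof.
move=> [s sE] [t tE]; exists (fun i => (s i \+ (\- t i) : {linear _ -> _})) => i x.
by rewrite chmDE chmNE sE tE /= linearB opprD addrACA.
Qed.

Lemma chm_nullMl C D E (g : chain_map D E) (f : chain_map C D) :
  chm_null f -> chm_null (chm_comp g f).
Proof.
move=> [s sE]; exists (fun i => (g i \o s i : {linear _ -> _})) => i x /=.
by rewrite sE linearD chmE.
Qed.

Lemma chm_nullMr C D E (g : chain_map D E) (f : chain_map C D) :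
  chm_null g -> chm_null (chm_comp g f).
Proof.
move=> [s sE]; exists (fun i => (s i \o f (i + 1) : {linear _ -> _})) => i x /=.
by rewrite sE chmE.
Qed.

Definition chain_homotopy : hom_ideal complex_cat :=
  @HomIdeal complex_cat
    (fun C D => Subgroup (@chm_null0 C D) (@chm_nullB C D))
    chm_nullMl chm_nullMr.

Definition homotopy_cat : preaddCat := quot_cat chain_homotopy.

Lemma shift_diffK C i (x : C (i + 1)) :
  (\- diff C (i + 1 + 1)) ((\- diff C (i + 1)) x) = 0.
Proof. by rewrite /= linearN opprK diffK. Qed.

Definition shift_obj C : complex R :=
  @Complex R (fun i => C (i + 1)) (fun i => (\- diff C (i + 1) : {linear _ -> _}))
    (@shift_diffK C).

Lemma shift_map_subproof C D (f : chain_map C D) i (x : shift_obj C i) :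
  f (i + 1 + 1) (diff (shift_obj C) i x) = diff (shift_obj D) i (f (i + 1) x).
Proof. by rewrite /= linearN chmE. Qed.

Definition shift_map C D (f : chain_map C D) :
    chain_map (shift_obj C) (shift_obj D) :=
  @ChainMap R (shift_obj C) (shift_obj D) (fun i => f (i + 1))
    (shift_map_subproof f).

Lemma shift_map1 C : shift_map (chm_id C) = chm_id (shift_obj C).
Proof. exact: chm_ext. Qed.

Lemma shift_mapM C D E (g : chain_map D E) (f : chain_map C D) :
  shift_map (chm_comp g f) = chm_comp (shift_map g) (shift_map f).
Proof. exact: chm_ext. Qed.

Definition shift : functor complex_cat complex_cat :=
  @Functor complex_cat complex_cat shift_obj shift_map shift_map1 shift_mapM.

Lemma shiftD : additive_functor shift.
Proof. by move=> C D f g; apply: chm_ext. Qed.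

Lemma shift_null (C D : complex_cat) (f : hom C D) :
  chain_homotopy C D f -> chain_homotopy _ _ (fmap shift f).
Proof.
move=> [s sE]; exists (fun i => (\- s (i + 1) : {linear _ -> _})) => i x /=.
by rewrite sE !linearN !opprK.
Qed.

Definition hshift : functor homotopy_cat homotopy_cat :=
  quot_functor shiftD shift_null.

Section Cone.
Context (C D : complex R) (f : chain_map C D).

Definition cone_diff_fun i (x : C (i + 1) * D i) :
    C (i + 1 + 1) * D (i + 1) :=
  (- diff C (i + 1) x.1, f (i + 1) x.1 + diff D i x.2).

Lemma cone_diff_linear i : linear (@cone_diff_fun i).
Proof.
move=> a x y; rewrite /cone_diff_fun /= !linearP; congr (_, _) => /=.
by rewrite scalerDr addrACA.
Qed.

HB.instance Definition _ i :=
  GRing.isLinear.Build _ _ _ _ (@cone_diff_fun i) (@cone_diff_linear i).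

Lemma cone_diffK i (x : C (i + 1) * D i) :
  cone_diff_fun (cone_diff_fun x) = 0.
Proof.
rewrite /cone_diff_fun /= !linearN !linearD /= !diffK oppr0 !addr0 chmE.
by rewrite addNr oppr0.
Qed.

Definition cone : complex R :=
  @Complex R (fun i : int => (C (i + 1)%R * D i)%type : rmodType R)
    (fun i => (@cone_diff_fun i : {linear _ -> _})) cone_diffK.

Definition cone_in_fun i (y : D i) : C (i + 1) * D i := (0, y).

Lemma cone_in_linear i : linear (@cone_in_fun i).
Proof. by move=> a x y; rewrite /cone_in_fun; congr (_, _) => /=; rewrite scaler0 addr0. Qed.

HB.instance Definition _ i :=
  GRing.isLinear.Build _ _ _ _ (@cone_in_fun i) (@cone_in_linear i).

Lemma cone_in_subproof i (y : D i) :
  cone_in_fun (diff D i y) = diff cone i (cone_in_fun y).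
Proof. by rewrite /= /cone_diff_fun /cone_in_fun /= !linear0 add0r. Qed.

Definition cone_in : chain_map D cone :=
  @ChainMap R D cone (fun i => (@cone_in_fun i : {linear _ -> _}))
    cone_in_subproof.

Definition cone_pr_fun i (x : C (i + 1) * D i) : C (i + 1) := x.1.

Lemma cone_pr_linear i : linear (@cone_pr_fun i).
Proof. by []. Qed.

HB.instance Definition _ i :=
  GRing.isLinear.Build _ _ _ _ (@cone_pr_fun i) (@cone_pr_linear i).

Lemma cone_pr_subproof i (x : cone i) :
  cone_pr_fun (diff cone i x) = diff (shift_obj C) i (cone_pr_fun x).
Proof. by []. Qed.

Definition cone_pr : chain_map cone (shift_obj C) :=
  @ChainMap R cone (shift_obj C) (fun i => (@cone_pr_fun i : {linear _ -> _}))
    cone_pr_subproof.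

Definition std_triangle : triangle hshift :=
  @Triangle homotopy_cat hshift C D cone
    (cls chain_homotopy (f : @hom complex_cat C D))
    (cls chain_homotopy (cone_in : @hom complex_cat D cone))
    (cls chain_homotopy (cone_pr : @hom complex_cat cone (shift C))).

End Cone.

Definition acyclic C : Prop :=
  forall (i : int) (x : C (i + 1)), diff C (i + 1) x = 0 -> exists y, x = diff C i y.

(** Exactness of [Hom_R(C, R)] at [Hom_R(C (i + 1), R)], for the regular right
    module [R]. *)
Definition dual_acyclic C : Prop :=
  forall i (u : {linear C (i + 1) -> (R^c)^o}),
    (forall x, u (diff C i x) = 0) ->
    exists v : {linear C (i + 1 + 1) -> (R^c)^o},
      forall x, u x = v (diff C (i + 1) x).

Definition totally_acyclic C : Prop := acyclic C /\ dual_acyclic C.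

Definition tac_proj C : Prop :=
  (forall i, fin_gen (C i) /\ projective (C i)) /\ totally_acyclic C.

Lemma tac_proj_shift C : tac_proj C -> tac_proj (shift_obj C).
Proof.
move=> [Cproj [Cac Cdac]]; split; first by move=> i; apply: Cproj.
split=> i.
  move=> x /= /eqP; rewrite oppr_eq0 => /eqP /Cac [y ->].
  by exists (- y); rewrite linearN opprK.
move=> u ux.
have [|v vE] := Cdac (i + 1) u.
  by move=> x; have /= := ux x; rewrite linearN => /eqP; rewrite oppr_eq0 => /eqP.
by exists (\- v) => x /=; rewrite linearN opprK vE.
Qed.

Definition ktac_cat : preaddCat := full_sub (tac_proj : homotopy_cat -> Prop).

Definition ktac_susp : functor ktac_cat ktac_cat :=
  corestrict (F := compF hshift (incl (tac_proj : homotopy_cat -> Prop)))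
    (fun X => tac_proj_shift (sobjP X)).

(** The inclusion of [ktac_cat] into [homotopy_cat] strictly commutes with the
    suspensions. *)
Definition ktac_incl_triangle (T : triangle ktac_susp) : triangle hshift :=
  @Triangle homotopy_cat hshift (sobj (tri1 T)) (sobj (tri2 T)) (sobj (tri3 T))
    (tri_u T) (tri_v T) (tri_w T).

Definition Ktac : triCat :=
  @TriCat ktac_cat ktac_susp
    (fun T => exists (C D : complex R) (f : chain_map C D),
       tri_iso (ktac_incl_triangle T) (std_triangle f)).

End ChainMaps.

Section RegularLocal.
Context (R : pzRingType).
Implicit Types (I J P m : set R).

(** Left ideals; these notions are only used under commutativity of [R], which
    is part of [regular_local]. *)
Definition ideal I : Prop :=
  [/\ I 0, forall x y, I x -> I y -> I (x + y) & forall a x, I x -> I (a * x)].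

Definition prime_ideal P : Prop :=
  [/\ ideal P, ~ P 1 & forall x y, P (x * y) -> P x \/ P y].

Definition maximal_ideal m : Prop :=
  [/\ ideal m, ~ m 1 & forall J, ideal J -> ~ J 1 -> (m `<=` J)%classic -> J = m].

Definition generated_by (n : nat) (x : 'I_n -> R) I : Prop :=
  I = [set y | exists a : 'I_n -> R, y = \sum_(i < n) a i * x i]%classic.

Definition noetherian : Prop :=
  forall I, ideal I -> exists (n : nat) (x : 'I_n -> R), generated_by x I.

Definition prime_chain (n : nat) (P : nat -> set R) : Prop :=
  (forall i : nat, (i <= n)%N -> prime_ideal (P i)) /\
  (forall i : nat, (i < n)%N -> (P i `<` P i.+1)%classic).

Definition krull_dim (d : nat) : Prop :=
  (exists P : nat -> set R, prime_chain d P) /\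
  (forall (n : nat) (P : nat -> set R), prime_chain n P -> (n <= d)%N).

Definition min_generators I (d : nat) : Prop :=
  (exists x : 'I_d -> R, generated_by x I) /\
  (forall (n : nat) (x : 'I_n -> R), generated_by x I -> (d <= n)%N).

Definition local_ring m : Prop :=
  maximal_ideal m /\ forall m', maximal_ideal m' -> m' = m.

(** [R] is a commutative regular local ring with maximal ideal [m]. *)
Definition regular_local m : Prop :=
  [/\ forall x y : R, x * y = y * x, noetherian, local_ring m &
      exists d : nat, krull_dim d /\ min_generators m d].

Definition ideal_mul I J : set R :=
  [set y | exists (n : nat) (a b : 'I_n -> R),
     (forall i, I (a i)) /\ (forall i, J (b i)) /\
     y = \sum_(i < n) a i * b i]%classic.

Definition regular_element (x : R) : Prop := GRing.lreg x /\ GRing.rreg x.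

End RegularLocal.

Definition endo (C : preaddCat) (M : C) : Type := hom M M.

Section Endo.
Context (C : preaddCat) (M : C).

HB.instance Definition _ := GRing.Zmodule.on (endo M).

Definition endo_mul (g f : endo M) : endo M := mcomp (g : hom M M) (f : hom M M).

Lemma endo_mulA : associative endo_mul.
Proof. move=> h g f; exact: compA. Qed.
Lemma endo_mul1l : left_id (idm M : endo M) endo_mul.
Proof. move=> f; exact: comp1m. Qed.
Lemma endo_mul1r : right_id (idm M : endo M) endo_mul.
Proof. move=> f; exact: compm1. Qed.
Lemma endo_mulDl : left_distributive endo_mul +%R.
Proof. move=> g g' f; exact: compDl. Qed.
Lemma endo_mulDr : right_distributive endo_mul +%R.
Proof. move=> g f f'; exact: compDr. Qed.

HB.instance Definition _ := GRing.Zmodule_isPzRing.Build (endo M)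
  endo_mulA endo_mul1l endo_mul1r endo_mulDl endo_mulDr.

End Endo.

Section Reduction.
Context (C : preaddCat) (eta : nat_trans (idF C) (idF C)) (M : C).
Implicit Types X Y Z : C.

Definition eta_multiple X (w : hom M X) : Prop := exists u : hom M X, w = u ∘ eta M.

Lemma eta_multiple0 X : eta_multiple (0 : hom M X).
Proof. by exists 0; rewrite comp0m. Qed.

Lemma eta_multipleB X (v w : hom M X) :
  eta_multiple v -> eta_multiple w -> eta_multiple (v - w).
Proof. by move=> [v' ->] [w' ->]; exists (v' - w'); rewrite compBl. Qed.

(** The subgroup [Hom(M, X) eta_M] of [Hom(M, X)]; for [X = M] it is the two-sided
    ideal [(eta_M)], since [eta_M] is central. *)
Definition eta_sub X : subgroup (hom M X) :=
  Subgroup (@eta_multiple0 X) (@eta_multipleB X).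

Definition ebar X : zmodType := zquot (eta_sub X).

Definition Gbar : Type := ebar M.

HB.instance Definition _ := GRing.Zmodule.on Gbar.

Definition ebar_act X (w : ebar X) (a : Gbar) : ebar X :=
  zpi (eta_sub X) (zrepr w ∘ zrepr (a : ebar M)).

Lemma ntc_comm X (f : hom M X) : f ∘ eta M = eta X ∘ f.
Proof. by have /= <- := ntcE eta f. Qed.

Lemma ebar_act_pi X (w : hom M X) (a : hom M M) :
  ebar_act (zpi (eta_sub X) w) (zpi (eta_sub M) a) = zpi (eta_sub X) (w ∘ a).
Proof.
apply/eq_zpi; set w' := zrepr _; set a' := zrepr _.
have [u uE] : eta_multiple (w' - w) := zrepr_zpi (eta_sub X) w.
have [b bE] : eta_multiple (a' - a) := zrepr_zpi (eta_sub M) a.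
exists (w' ∘ b + u ∘ a).
rewrite compDl -compA -bE -(compA u a) ntc_comm (compA u) -uE compBr compBl.
by rewrite addrA subrK.
Qed.

Definition Gbar1 : Gbar := zpi (eta_sub M) (idm M).
Definition Gbar_mul (a b : Gbar) : Gbar := ebar_act (a : ebar M) b.

Lemma ebar_actA X (w : ebar X) (a b : Gbar) :
  ebar_act (ebar_act w a) b = ebar_act w (Gbar_mul a b).
Proof.
have [w' ->] := zpiP w; have [a' ->] := zpiP a; have [b' ->] := zpiP b.
by rewrite /Gbar_mul !ebar_act_pi compA.
Qed.

Lemma ebar_act1 X (w : ebar X) : ebar_act w Gbar1 = w.
Proof. by have [w' ->] := zpiP w; rewrite ebar_act_pi compm1. Qed.

Lemma ebar_actDl X (w w' : ebar X) (a : Gbar) :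
  ebar_act (w + w') a = ebar_act w a + ebar_act w' a.
Proof.
have [v ->] := zpiP w; have [v' ->] := zpiP w'; have [a' ->] := zpiP a.
by rewrite -raddfD !ebar_act_pi compDl raddfD.
Qed.

Lemma ebar_actDr X (w : ebar X) (a b : Gbar) :
  ebar_act w (a + b) = ebar_act w a + ebar_act w b.
Proof.
have [v ->] := zpiP w; have [a' ->] := zpiP a; have [b' ->] := zpiP b.
by rewrite -[_ + zpi _ _]raddfD !ebar_act_pi compDr raddfD.
Qed.

Lemma Gbar_mulA : associative Gbar_mul.
Proof. by move=> a b c; rewrite -[LHS]ebar_actA. Qed.
Lemma Gbar_mul1l : left_id Gbar1 Gbar_mul.
Proof.
by move=> a; have [a' ->] := zpiP a; rewrite /Gbar_mul ebar_act_pi comp1m.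
Qed.
Lemma Gbar_mul1r : right_id Gbar1 Gbar_mul.
Proof. exact: ebar_act1. Qed.
Lemma Gbar_mulDl : left_distributive Gbar_mul +%R.
Proof. by move=> a b c; apply: ebar_actDl. Qed.
Lemma Gbar_mulDr : right_distributive Gbar_mul +%R.
Proof. by move=> a b c; apply: ebar_actDr. Qed.

HB.instance Definition _ := GRing.Zmodule_isPzRing.Build Gbar
  Gbar_mulA Gbar_mul1l Gbar_mul1r Gbar_mulDl Gbar_mulDr.

Definition ebar_mod X : Type := ebar X.

HB.instance Definition _ X := GRing.Zmodule.on (ebar_mod X).

Definition ebar_scale X (a : Gbar^c) (w : ebar_mod X) : ebar_mod X :=
  ebar_act (w : ebar X) (a : Gbar).

Lemma ebar_scaleA X (a b : Gbar^c) (w : ebar_mod X) :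
  ebar_scale a (ebar_scale b w) = ebar_scale (a * b) w.
Proof. exact: ebar_actA. Qed.
Lemma ebar_scale1 X : left_id 1 (@ebar_scale X).
Proof. by move=> w; apply: ebar_act1. Qed.
Lemma ebar_scaleDr X : right_distributive (@ebar_scale X) +%R.
Proof. by move=> a v w; apply: ebar_actDl. Qed.
Lemma ebar_scaleDl X (w : ebar_mod X) :
  {morph (@ebar_scale X)^~ w : a b / a + b >-> a + b}.
Proof. by move=> a b; apply: ebar_actDr. Qed.

HB.instance Definition _ X := GRing.Zmodule_isLmodule.Build Gbar^c (ebar_mod X)
  (@ebar_scaleA X) (@ebar_scale1 X) (@ebar_scaleDr X) (@ebar_scaleDl X).

Definition epi X (w : hom M X) : ebar_mod X := zpi (eta_sub X) w.

Lemma epiP X (q : ebar_mod X) : exists w, q = epi w.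
Proof. exact: zpiP. Qed.
Lemma epiD X (v w : hom M X) : epi (v + w) = epi v + epi w.
Proof. exact: (raddfD (zpi (eta_sub X))). Qed.
Lemma epiN X (w : hom M X) : epi (- w) = - epi w.
Proof. exact: (raddfN (zpi (eta_sub X))). Qed.
Lemma epi0 X : epi (0 : hom M X) = 0.
Proof. exact: (raddf0 (zpi (eta_sub X))). Qed.
Lemma epiZ X (a : hom M M) (w : hom M X) :
  (epi a : Gbar^c) *: epi w = epi (w ∘ a).
Proof. exact: ebar_act_pi. Qed.
Lemma epi_eq0 X (w : hom M X) : epi w = 0 <-> exists u, w = u ∘ eta M.
Proof. exact: zpi_eq0. Qed.
Lemma epi_eta X (w : hom M X) : epi (w ∘ eta M) = 0.
Proof. by apply/epi_eq0; exists w. Qed.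
Lemma eq_epi X (v w : hom M X) : epi v = epi w <-> exists u, v - w = u ∘ eta M.
Proof. exact: eq_zpi. Qed.

(** The map induced by [w |-> f w] on the quotients. *)
Definition ebar_map X Y (f : hom X Y) (w : ebar_mod X) : ebar_mod Y :=
  epi (f ∘ zrepr (w : ebar X)).

Lemma ebar_map_pi X Y (f : hom X Y) (w : hom M X) : ebar_map f (epi w) = epi (f ∘ w).
Proof.
apply/eq_epi.
have [u uE] : eta_multiple (zrepr (zpi (eta_sub X) w) - w) :=
  zrepr_zpi (eta_sub X) w.
by exists (f ∘ u); rewrite -compBr uE compA.
Qed.

Lemma ebar_map_linear X Y (f : hom X Y) : linear (ebar_map f).
Proof.
move=> a v w; have [v' ->] := epiP v; have [w' ->] := epiP w.
have [a' ->] := @epiP M a.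
by rewrite epiZ -epiD !ebar_map_pi epiZ -epiD compDr compA.
Qed.

HB.instance Definition _ X Y (f : hom X Y) :=
  GRing.isLinear.Build Gbar^c (ebar_mod X) (ebar_mod Y) _ (ebar_map f)
    (@ebar_map_linear X Y f).

Lemma ebar_map1 X (w : ebar_mod X) : ebar_map (idm X) w = w.
Proof. by have [w' ->] := epiP w; rewrite ebar_map_pi comp1m. Qed.
Lemma ebar_mapM X Y Z (g : hom Y Z) (f : hom X Y) (w : ebar_mod X) :
  ebar_map (g ∘ f) w = ebar_map g (ebar_map f w).
Proof. by have [w' ->] := epiP w; rewrite !ebar_map_pi compA. Qed.
Lemma ebar_mapD X Y (f g : hom X Y) (w : ebar_mod X) :
  ebar_map (f + g) w = ebar_map f w + ebar_map g w.
Proof. by have [w' ->] := epiP w; rewrite !ebar_map_pi compDl epiD. Qed.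
Lemma ebar_map0 X Y (w : ebar_mod X) : ebar_map (0 : hom X Y) w = 0.
Proof. by have [w' ->] := epiP w; rewrite !ebar_map_pi comp0m epi0. Qed.
Lemma ebar_mapN X Y (f : hom X Y) (w : ebar_mod X) :
  ebar_map (- f) w = - ebar_map f w.
Proof. by have [w' ->] := epiP w; rewrite !ebar_map_pi compNm epiN. Qed.
Lemma ebar_map_eta X (w : ebar_mod X) : ebar_map (eta X : hom X X) w = 0.
Proof.
by have [w' ->] := epiP w; rewrite ebar_map_pi -ntc_comm epi_eta.
Qed.

End Reduction.

Section AddM.
Context (C : addCat) (M : C).

Lemma comp_suml (X Y Z : C) (I : Type) (s : seq I) (g : I -> hom Y Z)
    (f : hom X Y) :
  (\sum_(k <- s) g k) ∘ f = \sum_(k <- s) g k ∘ f.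
Proof.
by elim: s => [|k s IHs]; rewrite ?big_nil ?comp0m // !big_cons compDl IHs.
Qed.

Lemma comp_sumr (X Y Z : C) (I : Type) (s : seq I) (g : hom Y Z)
    (f : I -> hom X Y) :
  g ∘ (\sum_(k <- s) f k) = \sum_(k <- s) g ∘ f k.
Proof.
by elim: s => [|k s IHs]; rewrite ?big_nil ?compm0 // !big_cons compDr IHs.
Qed.

Lemma copies_dual_basis (n : nat) :
  exists s : seq (hom M (copies M n) * hom (copies M n) M),
    \sum_(p <- s) p.1 ∘ p.2 = idm (copies M n).
Proof.
elim: n => [|n [s sE]].
  by exists [::]; rewrite big_nil /= (to_zobj (idm (zobj C))).
exists ((inj1, prj1) :: [seq (inj2 ∘ p.1, p.2 ∘ prj2) | p <- s]).
rewrite big_cons big_map /= -bip_id; congr (_ + _).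
rewrite -[in RHS](comp1m prj2) -sE.
rewrite comp_suml comp_sumr.
by apply: eq_bigr => p _; rewrite !compA.
Qed.

Lemma add_dual_basis (X : C) : in_add M X ->
  exists (n : nat) (x : 'I_n -> hom M X) (y : 'I_n -> hom X M),
    \sum_(k < n) x k ∘ y k = idm X.
Proof.
move=> [n [_ [i [p pi]]]]; have [s sE] := copies_dual_basis n.
exists (size s), (fun k => p ∘ (tnth (in_tuple s) k).1),
  (fun k => (tnth (in_tuple s) k).2 ∘ i).
rewrite -pi -[in RHS](comp1m i) -sE [in RHS]big_tnth.
rewrite comp_suml comp_sumr.
by apply: eq_bigr => k _; rewrite !compA.
Qed.

End AddM.

Section Reduced.
Context (C : addCat) (eta : nat_trans (idF C) (idF C)) (M : C).
Context (addM : forall X : C, in_add M X).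
Context (etaM : @regular_element (endo M) (eta M)).

Lemma eta_regular (X : C) (v : hom M X) : v ∘ eta M = 0 -> v = 0.
Proof.
move=> v0; have [n [x [y xy]]] := add_dual_basis (addM X).
rewrite -[v]comp1m -xy comp_suml big1 // => k _.
suff yv : y k ∘ v = 0 by rewrite -compA yv compm0.
have [_ reg] := etaM; apply: (reg (y k ∘ v : endo M) 0).
by rewrite mul0r; change ((y k ∘ v) ∘ eta M = 0); rewrite -compA v0 compm0.
Qed.

Lemma ebar_fin_gen (X : C) : @fin_gen (Gbar eta M)^c (ebar_mod eta M X).
Proof.
have [n [x [y xy]]] := add_dual_basis (addM X).
exists n, (fun k => epi eta (x k)) => q; have [w ->] := epiP q.
exists (fun k => epi eta (y k ∘ w) : Gbar eta M).
rewrite -[w in LHS]comp1m -xy comp_suml.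
rewrite (big_morph (@epi _ eta M X) (@epiD _ eta M X) (@epi0 _ eta M X)).
by apply: eq_bigr => k _; rewrite epiZ compA.
Qed.

Lemma ebar_projective (X : C) : @projective (Gbar eta M)^c (ebar_mod eta M X).
Proof.
move=> A B p f psurj; have [n [x [y xy]]] := add_dual_basis (addM X).
have [a aE] := choice (fun k => psurj (f (epi eta (x k)))).
pose g (w : ebar_mod eta M X) : A :=
  \sum_(k < n) (ebar_map (y k) w : (Gbar eta M)^c) *: a k.
have glin : linear g.
  move=> c v w; rewrite /g scaler_sumr -big_split; apply: eq_bigr => k _ /=.
  by rewrite linearP scalerA -scalerDl.
pose gl := GRing.isLinear.Build _ _ _ _ g glin.
pose G : {linear ebar_mod eta M X -> A} := HB.pack g gl.
exists G => q; have [w ->] := epiP q; rewrite /= /g linear_sum.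
rewrite -[in RHS](comp1m w) -xy comp_suml.
rewrite (big_morph (@epi _ eta M X) (@epiD _ eta M X) (@epi0 _ eta M X)).
rewrite linear_sum; apply: eq_bigr => k _.
by rewrite linearZ /= aE ebar_map_pi -compA -epiZ linearZ.
Qed.

Definition to_regular (w : ebar_mod eta M M) : ((Gbar eta M)^c)^o := w.

Lemma to_regular_linear : linear to_regular.
Proof. by []. Qed.

HB.instance Definition _ :=
  GRing.isLinear.Build _ _ _ _ to_regular to_regular_linear.

Lemma ebar_form (X : C) (u : {linear ebar_mod eta M X -> ((Gbar eta M)^c)^o}) :
  exists h : hom X M, forall w, u w = to_regular (ebar_map h w).
Proof.
have [n [x [y xy]]] := add_dual_basis (addM X).
have [c cE] := choice (fun k => @epiP C eta M M (u (epi eta (x k)))).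
exists (\sum_(k < n) c k ∘ y k) => q; have [w ->] := epiP q.
rewrite ebar_map_pi comp_suml.
rewrite (big_morph (@epi _ eta M M) (@epiD _ eta M M) (@epi0 _ eta M M)).
rewrite linear_sum -[w in LHS]comp1m -xy comp_suml.
rewrite (big_morph (@epi _ eta M X) (@epiD _ eta M X) (@epi0 _ eta M X)).
rewrite linear_sum; apply: eq_bigr => k _.
by rewrite -!compA -!epiZ linearZ cE.
Qed.

Lemma ebar_exact (X Y : C) (f : hom X Y) (g : hom Y X) (w : ebar_mod eta M X) :
  g ∘ f = eta X -> f ∘ g = eta Y ->
  ebar_map f w = 0 -> exists y, w = ebar_map g y.
Proof.
move=> gf fg; have [v ->] := epiP w; rewrite ebar_map_pi => /epi_eq0 [u uE].
exists (epi eta u); rewrite ebar_map_pi; congr epi.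
apply/eqP; rewrite -subr_eq0; apply/eqP/eta_regular.
have : f ∘ (v - g ∘ u) = 0.
  by rewrite compBr uE compA fg -ntc_comm subrr.
by rewrite ntc_comm -gf -compA => ->; rewrite compm0.
Qed.

Lemma ebar_dual_exact (X Y : C) (f : hom X Y) (g : hom Y X)
    (u : {linear ebar_mod eta M Y -> ((Gbar eta M)^c)^o}) :
  g ∘ f = eta X -> f ∘ g = eta Y ->
  (forall w, u (ebar_map f w) = 0) ->
  exists t : hom X M, forall w, u w = to_regular (ebar_map t (ebar_map g w)).
Proof.
move=> gf fg; have [h hE] := ebar_form u => u0.
have [n [x [y xy]]] := add_dual_basis (addM X).
have hfx (k : 'I_n) : exists t : hom M M, h ∘ f ∘ x k = t ∘ eta M.
  have := u0 (epi eta (x k)).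
  by rewrite hE !ebar_map_pi compA => /epi_eq0.
have [t tE] := choice hfx.
have hf : h ∘ f = (\sum_(k < n) t k ∘ y k) ∘ eta X.
  rewrite -[LHS]compm1 -xy comp_sumr comp_suml; apply: eq_bigr => k _.
  rewrite compA tE -!compA; congr (_ ∘ _).
  by have /= := ntcE eta (y k).
exists (\sum_(k < n) t k ∘ y k) => q; have [w ->] := epiP q.
rewrite hE !ebar_map_pi; congr (to_regular (epi _ _)).
apply/eqP; rewrite -subr_eq0; apply/eqP/eta_regular.
set s := \sum_(k < n) _ in hf *.
rewrite compBl -!compA !ntc_comm -fg !compA hf -gf !compA.
by rewrite subrr.
Qed.

End Reduced.

Definition parity (i : int) : bool := odd `|i|%N.

Lemma parityS (i : int) : parity (i + 1) = ~~ parity i.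
Proof.
rewrite /parity; case: i => n.
  by rewrite (_ : Posz n + 1 = Posz n.+1) // -[1]/(Posz 1) -PoszD addn1.
case: n => [|n] //.
rewrite (_ : Negz n.+1 + 1 = Negz n); first by rewrite /= negbK.
by rewrite !NegzE -[n.+2]addn1 PoszD opprD addrNK.
Qed.

Lemma chm_bij_iso (R : pzRingType) (D E : complex R) (f : chain_map D E)
    (g : forall i, {linear E i -> D i}) :
  (forall i x, g i (f i x) = x) -> (forall i x, f i (g i x) = x) ->
  is_iso (cls (chain_homotopy R) (f : @hom (complex_cat R) D E)).
Proof.
move=> gf fg.
have gE i (x : E i) : g (i + 1) (diff E i x) = diff D i (g i x).
  by rewrite -[in LHS](fg i x) -chmE gf.
exists (cls (chain_homotopy R) (ChainMap gE : @hom (complex_cat R) E D)).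
rewrite -!cls_comp; split.
  by congr cls; apply: chm_ext => i x; apply: gf.
by congr cls; apply: chm_ext => i x; apply: fg.
Qed.

Section Periodic.
Context (C : addCat) (eta : nat_trans (idF C) (idF C)) (M : C).
Implicit Types X Y Z : fact eta.
Implicit Types b c d : bool.

(** The object and the maps of a factorization sitting in a degree of parity [b]
    ([fac1] in even degrees), so that the differential of the periodic complex
    can be written without casts; only the cases [c = ~~ b] of [fdif] are used. *)
Definition fsel X b : C := if b then fac2 X else fac1 X.

Definition fdif X b c : hom (fsel X b) (fsel X c) :=
  match b, c with
  | false, true => fac_f1 X
  | true, false => fac_f2 X
  | _, _ => 0
  end.

Definition fhom X Y (phi : fact_hom X Y) b : hom (fsel X b) (fsel Y b) :=
  match b with
  | false => phi.1
  | true => phi.2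
  end.

Lemma fdif_eta X b c : c = ~~ b -> fdif X c b ∘ fdif X b c = eta (fsel X b).
Proof. by move=> ->; case: b; [apply: fac_f1f2|apply: fac_f2f1]. Qed.

Lemma fhomE X Y (phi : fact_hom X Y) b c : c = ~~ b ->
  fhom phi c ∘ fdif X b c = fdif Y b c ∘ fhom phi b.
Proof. by move=> ->; case: b; [apply: fact_homE2|apply: fact_homE1]. Qed.

Lemma per_diffK_subproof X b c d (x : ebar_mod eta M (fsel X b)) :
  c = ~~ b -> d = ~~ c -> ebar_map (fdif X c d) (ebar_map (fdif X b c) x) = 0.
Proof.
move=> cb dc; have db : d = b by rewrite dc cb negbK.
by rewrite db -ebar_mapM fdif_eta // ebar_map_eta.
Qed.

Lemma per_diffK X (i : int) (x : ebar_mod eta M (fsel X (parity i))) :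
  ebar_map (fdif X (parity (i + 1)) (parity (i + 1 + 1)))
    (ebar_map (fdif X (parity i) (parity (i + 1))) x) = 0.
Proof. by apply: per_diffK_subproof; apply: parityS. Qed.

Definition per_cpx X : complex (Gbar eta M) :=
  @Complex (Gbar eta M)
    (fun i => ebar_mod eta M (fsel X (parity i)) : rmodType (Gbar eta M))
    (fun i => (ebar_map (fdif X (parity i) (parity (i + 1))) : {linear _ -> _}))
    (@per_diffK X).

Lemma per_map_subproof X Y (phi : fact_hom X Y) (i : int) (x : per_cpx X i) :
  ebar_map (fhom phi (parity (i + 1))) (diff (per_cpx X) i x) =
  diff (per_cpx Y) i (ebar_map (fhom phi (parity i)) x).
Proof. by rewrite /= -!ebar_mapM fhomE // parityS. Qed.

Definition per_map X Y (phi : fact_hom X Y) :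
    chain_map (per_cpx X) (per_cpx Y) :=
  @ChainMap (Gbar eta M) (per_cpx X) (per_cpx Y)
    (fun i => (ebar_map (fhom phi (parity i)) : {linear _ -> _}))
    (per_map_subproof phi).

Lemma fhom1 X b : fhom (fact_id X) b = idm (fsel X b).
Proof. by case: b. Qed.

Lemma fhomM X Y Z (psi : fact_hom Y Z) (phi : fact_hom X Y) b :
  fhom (fact_comp psi phi) b = fhom psi b ∘ fhom phi b.
Proof. by case: b. Qed.

Lemma fhomD X Y (phi psi : fact_hom X Y) b :
  fhom (phi + psi) b = fhom phi b + fhom psi b.
Proof. by case: b. Qed.

Lemma per_map1 X : per_map (fact_id X) = chm_id (per_cpx X).
Proof. by apply: chm_ext => i x; rewrite /= fhom1 ebar_map1. Qed.

Lemma per_mapM X Y Z (psi : fact_hom Y Z) (phi : fact_hom X Y) :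
  per_map (fact_comp psi phi) = chm_comp (per_map psi) (per_map phi).
Proof. by apply: chm_ext => i x; rewrite /= fhomM ebar_mapM. Qed.

Definition per : functor (fact_cat eta) (complex_cat (Gbar eta M)) :=
  @Functor (fact_cat eta) (complex_cat (Gbar eta M)) per_cpx per_map
    per_map1 per_mapM.

Lemma perD : additive_functor per.
Proof. by move=> X Y f g; apply: chm_ext => i x; rewrite /= fhomD ebar_mapD. Qed.

Definition fhtp X Y (s1 : hom (fac2 X) (fac1 Y)) (s2 : hom (fac1 X) (fac2 Y)) b c :
    hom (fsel X b) (fsel Y c) :=
  match b, c with
  | false, true => s2
  | true, false => s1
  | _, _ => 0
  end.

Lemma per_null (X Y : fact_cat eta) (phi : hom X Y) :
  fact_homotopy eta X Y phi -> chain_homotopy (Gbar eta M) _ _ (fmap per phi).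
Proof.
move=> [s1 [s2 [e1 e2]]].
exists (fun i => (ebar_map (fhtp s1 s2 (parity (i + 1)) (parity i)) : {linear _ -> _})).
move=> i x /=; rewrite -!ebar_mapM -ebar_mapD; congr (ebar_map _ x).
rewrite (parityS (i + 1)) (parityS i).
by case: (parity i); rewrite /= ?e1 ?e2 addrC.
Qed.

Definition hper : functor (hfact_cat eta) (homotopy_cat (Gbar eta M)) :=
  quot_functor perD per_null.

Definition fsusp X b c : hom (fsel (fact_susp_obj X) b) (fsel X c) :=
  match b, c with
  | false, true => idm (fac2 X)
  | true, false => idm (fac1 X)
  | _, _ => 0
  end.

Definition fsusp' X b c : hom (fsel X c) (fsel (fact_susp_obj X) b) :=
  match b, c with
  | false, true => idm (fac2 X)
  | true, false => idm (fac1 X)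
  | _, _ => 0
  end.

Lemma per_susp_subproof X (i : int) (x : per_cpx (fact_susp_obj X) i) :
  ebar_map (fsusp X (parity (i + 1)) (parity (i + 1 + 1)))
    (diff (per_cpx (fact_susp_obj X)) i x) =
  diff (shift_obj (per_cpx X)) i (ebar_map (fsusp X (parity i) (parity (i + 1))) x).
Proof.
rewrite /= -!ebar_mapM -ebar_mapN; congr (ebar_map _ x).
rewrite (parityS (i + 1)) (parityS i).
by case: (parity i); rewrite /= comp1m compm1.
Qed.

(** The identity in every degree. *)
Definition per_susp X :
    chain_map (per_cpx (fact_susp_obj X)) (shift_obj (per_cpx X)) :=
  @ChainMap (Gbar eta M) (per_cpx (fact_susp_obj X)) (shift_obj (per_cpx X))
    (fun i => (ebar_map (fsusp X (parity i) (parity (i + 1))) : {linear _ -> _}))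
    (@per_susp_subproof X).

Definition hper_susp_map (X : hfact_cat eta) :
    hom (compF hper (hfact_susp eta) X) (compF (hshift (Gbar eta M)) hper X) :=
  cls (chain_homotopy (Gbar eta M))
    (per_susp X : @hom (complex_cat (Gbar eta M)) _ _).

Lemma hper_susp_nat (X Y : hfact_cat eta) (f : hom X Y) :
  hper_susp_map Y ∘ fmap (compF hper (hfact_susp eta)) f =
  fmap (compF (hshift (Gbar eta M)) hper) f ∘ hper_susp_map X.
Proof.
have [phi ->] := clsP f; rewrite /= !qmap_cls; try first [exact: shiftD | exact: shift_null | exact: perD
  | exact: per_null | exact: fact_suspD | exact: fact_susp_null].
apply: (etrans (esym (@cls_comp _ (chain_homotopy _) _ _ _
  (per_susp Y) (per_map (fact_susp_map phi))))).
apply: (etrans _ (@cls_comp _ (chain_homotopy _) _ _ _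
  (shift_map (per_map phi)) (per_susp X))).
congr cls; apply: chm_ext => i x; rewrite /= -!ebar_mapM; congr (ebar_map _ x).
rewrite (parityS i).
by case: (parity i); rewrite /= comp1m compm1.
Qed.

Definition hper_susp :
    nat_trans (compF hper (hfact_susp eta)) (compF (hshift (Gbar eta M)) hper) :=
  @NatTrans _ _ (compF hper (hfact_susp eta)) (compF (hshift (Gbar eta M)) hper)
    hper_susp_map hper_susp_nat.

Lemma hper_susp_iso : nat_iso hper_susp.
Proof.
move=> X; apply: (@chm_bij_iso _ (per_cpx (fact_susp_obj X))
  (shift_obj (per_cpx X)) (per_susp X)
  (fun i => (ebar_map (fsusp' X (parity i) (parity (i + 1))) : {linear _ -> _}))).
- move=> i x; rewrite /= -ebar_mapM -[RHS]ebar_map1; congr (ebar_map _ x).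
  by rewrite (parityS i); case: (parity i); rewrite /= comp1m.
- move=> i x; rewrite /= -ebar_mapM -[RHS]ebar_map1; congr (ebar_map _ x).
  by rewrite (parityS i); case: (parity i); rewrite /= comp1m.
Qed.

Section ConeComparison.
Context (X Y : fact eta) (phi : fact_hom X Y).

Definition kap1 b c : hom (fsel (fact_cone phi) b) (fsel X c) :=
  match b, c with
  | false, true => prj1
  | true, false => prj1
  | _, _ => 0
  end.

Definition kap2 b : hom (fsel (fact_cone phi) b) (fsel Y b) :=
  match b with
  | false => prj2
  | true => prj2
  end.

Definition lam1 b c : hom (fsel X c) (fsel (fact_cone phi) b) :=
  match b, c with
  | false, true => inj1
  | true, false => inj1
  | _, _ => 0
  end.

Definition lam2 b : hom (fsel Y b) (fsel (fact_cone phi) b) :=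
  match b with
  | false => inj2
  | true => inj2
  end.

Definition kap_fun (i : int) (w : per_cpx (fact_cone phi) i) : cone (per_map phi) i :=
  (ebar_map (kap1 (parity i) (parity (i + 1))) w : per_cpx X (i + 1),
   ebar_map (kap2 (parity i)) w : per_cpx Y i).

Lemma kap_linear (i : int) : linear (@kap_fun i).
Proof. by move=> a v w; rewrite /kap_fun !linearP. Qed.

HB.instance Definition _ (i : int) :=
  GRing.isLinear.Build _ _ _ _ (@kap_fun i) (@kap_linear i).

Lemma kap_subproof (i : int) (w : per_cpx (fact_cone phi) i) :
  kap_fun (diff (per_cpx (fact_cone phi)) i w) =
  diff (cone (per_map phi)) i (kap_fun w).
Proof.
rewrite /= /cone_diff_fun /kap_fun /=; congr (_, _).
  rewrite -!ebar_mapM -ebar_mapN; congr (ebar_map _ w).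
  rewrite (parityS (i + 1)) (parityS i).
  by case: (parity i); rewrite /= prj1_mx comp0m addr0 compNm.
rewrite -!ebar_mapM -ebar_mapD; congr (ebar_map _ w).
rewrite (parityS i).
by case: (parity i); rewrite /= prj2_mx.
Qed.

Definition kap : chain_map (per_cpx (fact_cone phi)) (cone (per_map phi)) :=
  @ChainMap _ (per_cpx (fact_cone phi)) (cone (per_map phi))
    (fun i => (@kap_fun i : {linear _ -> _})) kap_subproof.

Definition lam_fun (i : int) (x : cone (per_map phi) i) : per_cpx (fact_cone phi) i :=
  ebar_map (lam1 (parity i) (parity (i + 1))) x.1 + ebar_map (lam2 (parity i)) x.2.

Lemma lam_linear (i : int) : linear (@lam_fun i).
Proof. by move=> a v w; rewrite /lam_fun !linearP /= addrACA -scalerDr. Qed.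

HB.instance Definition _ (i : int) :=
  GRing.isLinear.Build _ _ _ _ (@lam_fun i) (@lam_linear i).

Lemma kap_iso :
  is_iso (cls (chain_homotopy (Gbar eta M))
            (kap : @hom (complex_cat (Gbar eta M)) _ _)).
Proof.
apply: (@chm_bij_iso _ _ _ kap (fun i => (@lam_fun i : {linear _ -> _}))).
  move=> i w; rewrite /= /lam_fun /kap_fun /= -!ebar_mapM -ebar_mapD.
  rewrite -[RHS]ebar_map1; congr (ebar_map _ w); rewrite (parityS i).
  by case: (parity i); rewrite /= bip_id.
move=> i [x y]; rewrite /= /lam_fun /kap_fun /= !linearD /= -!ebar_mapM.
have e11 b c : c = ~~ b -> kap1 b c ∘ lam1 b c = idm _.
  by move=> ->; case: b; rewrite /= prj1_inj1.
have e12 b c : c = ~~ b -> kap1 b c ∘ lam2 b = 0.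
  by move=> ->; case: b; rewrite /= prj1_inj2.
have e21 b c : c = ~~ b -> kap2 b ∘ lam1 b c = 0.
  by move=> ->; case: b; rewrite /= prj2_inj1.
have e22 b : kap2 b ∘ lam2 b = idm _ by case: b; rewrite /= prj2_inj2.
rewrite e22 e11 ?e12 ?e21 ?parityS //.
by rewrite !ebar_map0 !ebar_map1 addr0 add0r.
Qed.

Lemma hper_std_triangle :
  tri_iso (tri_map hper_susp (fact_std_triangle phi))
          (std_triangle (per_map phi)).
Proof.
exists (idm _), (idm _), (cls (chain_homotopy (Gbar eta M))
  (kap : @hom (complex_cat (Gbar eta M)) _ _)).
split; first by split; [apply: is_iso_id|apply: is_iso_id|apply: kap_iso].
have hperE (V W : fact_cat eta) (f : hom V W) :
  fmap hper (cls (fact_homotopy eta) f) = cls (chain_homotopy _) (fmap per f).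
  exact: (qmap_cls perD per_null).
split.
- apply: etrans (comp1m _) _; apply: etrans _ (esym (compm1 _)); exact: hperE.
- apply: etrans _ (esym (compm1 _)).
  apply: (etrans (congr1 (mcomp _) (hperE _ _ _))).
  apply: (etrans (esym (@cls_comp _ (chain_homotopy _) _ _ _
    kap (per_map (fact_cone_in phi))))).
  congr cls; apply: chm_ext => i w.
  rewrite /= /kap_fun /cone_in_fun -!ebar_mapM.
  rewrite -[in RHS](ebar_map1 w) -(ebar_map0 (fsel X (parity (i + 1))) w).
  by congr (ebar_map _ w, ebar_map _ w); rewrite ?(parityS i); case: (parity i);
    rewrite /= ?prj1_inj2 ?prj2_inj2.
- apply: (etrans (congr1 (fun f => f ∘ _) (fmap1 _ _))).
  apply: etrans (comp1m _) _.
  apply: (etrans (congr1 (mcomp _) (hperE _ _ _))).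
  apply: (etrans (esym (@cls_comp _ (chain_homotopy _) _ _ _
    (per_susp X) (per_map (fact_cone_pr phi))))).
  apply: (etrans _ (@cls_comp _ (chain_homotopy _) _ _ _
    (cone_pr (per_map phi)) kap)).
  congr cls; apply: chm_ext => i w; rewrite /= /kap_fun /cone_pr_fun /= -ebar_mapM.
  congr (ebar_map _ w).
  by rewrite (parityS i); case: (parity i); rewrite /= comp1m.
Qed.

End ConeComparison.

Context (addM : forall X : C, in_add M X).
Context (etaM : @regular_element (endo M) (eta M)).

Lemma per_acyclic_subproof X b c d (x : ebar_mod eta M (fsel X c)) :
  c = ~~ b -> d = ~~ c -> ebar_map (fdif X c d) x = 0 ->
  exists y, x = ebar_map (fdif X b c) y.
Proof.
move=> cb dc; have db : b = d by rewrite dc cb negbK.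
by rewrite db; apply: (ebar_exact addM etaM); apply: fdif_eta; rewrite ?dc ?negbK.
Qed.

Lemma per_tac_proj X : tac_proj (per_cpx X).
Proof.
split; first by move=> i; split; [apply: ebar_fin_gen|apply: ebar_projective].
split=> i.
  by move=> x; apply: per_acyclic_subproof; apply: parityS.
move=> u u0.
have dc : parity (i + 1 + 1) = parity i by rewrite !parityS negbK.
have [t tE] : exists t : hom (fsel X (parity (i + 1 + 1))) M, forall w,
    u w = to_regular (ebar_map t (diff (per_cpx X) (i + 1) w)).
  rewrite /= dc; apply: (ebar_dual_exact addM etaM (f := fdif X (parity i) (parity (i + 1)))) => //;
    by apply: fdif_eta; rewrite ?parityS ?negbK.
exists (@to_regular C eta M \o ebar_map t : {linear _ -> _}) => x.
exact: tE.
Qed.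

Definition ktac_fun : functor (hfact_cat eta) (ktac_cat (Gbar eta M)) :=
  corestrict (F := hper) per_tac_proj.

Definition ktac_fun_susp :
    nat_trans (compF ktac_fun (hfact_susp eta))
              (compF (ktac_susp (Gbar eta M)) ktac_fun) :=
  @NatTrans _ _ (compF ktac_fun (hfact_susp eta))
    (compF (ktac_susp (Gbar eta M)) ktac_fun) hper_susp_map hper_susp_nat.

Lemma ktac_fun_dist (T : triangle (hfact_susp eta)) :
  @dist (HFact eta) T -> @dist (Ktac (Gbar eta M)) (tri_map ktac_fun_susp T).
Proof.
move=> [X [Y [phi iso]]]; exists (per_cpx X), (per_cpx Y), (per_map phi).
apply: tri_iso_trans (hper_std_triangle phi).
exact: (tri_iso_map hper_susp iso).
Qed.

Definition HFact_to_Ktac : tri_functor (HFact eta) (Ktac (Gbar eta M)) :=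
  @TriFunctor (HFact eta) (Ktac (Gbar eta M)) ktac_fun
    (quot_functorD perD per_null) ktac_fun_susp hper_susp_iso ktac_fun_dist.

End Periodic.

(* Main.v *)
From HB Require Import structures.
From mathcomp Require Import all_boot all_algebra ring zify.
From mathcomp Require Import boolp classical_sets.
Require Import Defs.

(** Write [Q] for the endomorphism ring of [M], [x] for [eta M], [R] for [Q/(x)].

    The functor is fully faithful as soon as [x] is regular.  Between totally
    acyclic complexes of finitely generated projective modules a chain map that
    vanishes in degree 0 is null-homotopic ([chain_map_null]), so only degree 0
    matters.  There, a chain map between the periodic complexes of two
    factorizations lifts to a morphism of factorizations ([per_full]), because
    both maps of a factorization are cancellable, and a homotopy lifts likewise
    ([per_faithful]).

    Density is where the regularity of [Q] is used.  Let [K] be a totally acyclic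
    complex over [R].  Its modules are free ([ebar_free]), so [K] lifts to maps
    [D i : X i -> X (i + 1)] between sums of copies of [M], with
    [D (i + 1) D i = T i x].  The objects [X i + X (i + 1)] with the differentials
    of rows [(D, -x)] and [(T, -D)] form a complex which is exact after applying [Hom(M, -)]
    ([total_diff_exact]): it resolves [K] over [Q], and it is unbounded in both
    directions.  Every module of cycles of an unbounded exact complex of free
    modules is an [n]-th syzygy for all [n], hence free over a regular local ring
    ([free_cover]).  The cycles in degree [i] project isomorphically onto the
    preimage [L] in [Hom(M, X i)] of the cycles of [K]; since [L] is free, multiplication by [x]
    from [X i] to [L] and the inclusion of [L] in [X i] are a factorization of [x]
    ([cycles_factorization]).  Its periodic complex has the same module and the
    same cycles in degree 0 as [K], and is therefore homotopy equivalent to [K]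
    ([homotopy_equiv_of_degree0]).

    That the cycles are free is seen without homological dimension.  The maximal
    ideal is generated by elements [x_0, ..., x_(d-1)] such that [x_j] is regular
    modulo [I_j = (x_0, ..., x_(j-1))].  Call [L] inside [F = Hom(M, X)] pure
    for [j] when [L] meets [F I_j] in [L I_j].  If the image of a map is pure for
    all [j < k], its kernel is pure for [k] ([pure_kernel]), so in an unbounded
    exact complex all cycles are pure for all [j <= d].  The relations [Z] between
    minimal generators of such a module of cycles lie in [F I_d] for a free [F], hence in
    [Z I_d], and vanish by Nakayama's lemma.

    The regular sequence comes from dimension theory inside [Q].  By Krull's
    principal ideal theorem ([krull_hauptidealsatz]) a chain of primes can be
    rerouted through any element of the maximal ideal at its second member
    ([prime_chain_through]).  Applied to successive generators of the maximal
    ideal this bounds the length of chains above [I_j] by [d - j]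
    ([prime_chain_bound]), and for a chain of that length it forces [I_j] to be its
    least member, hence prime ([partial_ideal_regular]). *)

Set Implicit Arguments.
Unset Strict Implicit.
Unset Printing Implicit Defensive.

Import GRing.Theory.
Local Open Scope ring_scope.

(** * Krull's principal ideal theorem *)

Section Ideals.
Context (R : comPzRingType).
Implicit Types (I J K P p q m : set R).

Lemma ideal0 I : ideal I -> I 0.
Proof. by case. Qed.

Lemma idealD I x y : ideal I -> I x -> I y -> I (x + y).
Proof. by case=> _ + _; apply. Qed.

Lemma idealMl I a x : ideal I -> I x -> I (a * x).
Proof. by case=> _ _; apply. Qed.

Lemma idealMr I a x : ideal I -> I x -> I (x * a).
Proof. by rewrite mulrC; apply: idealMl. Qed.

Lemma idealN I x : ideal I -> I x -> I (- x).
Proof. by rewrite -mulN1r; apply: idealMl. Qed.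

Lemma idealB I x y : ideal I -> I x -> I y -> I (x - y).
Proof. by move=> iI Ix Iy; apply: idealD => //; apply: idealN. Qed.

Lemma ideal_sum I n (F : 'I_n -> R) : ideal I -> (forall i, I (F i)) ->
  I (\sum_(i < n) F i).
Proof.
move=> iI IF; elim/big_ind: _ => // [|x y]; [exact: ideal0|exact: idealD].
Qed.

Lemma prime_idealP P : prime_ideal P -> ideal P. Proof. by case. Qed.

(** The ideal [I + R x], when [I] is an ideal. *)
Definition adjoin I x : set R := fun z => exists a b, I a /\ z = a + b * x.

Lemma ideal_adjoin I x : ideal I -> ideal (adjoin I x).
Proof.
move=> iI; split=> [|_ _ [a [b [Ia ->]]] [c [e [Ic ->]]]|c _ [a [b [Ia ->]]]].
- by exists 0, 0; split; [apply: ideal0 | ring].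
- by exists (a + c), (b + e); split; [apply: idealD | ring].
- by exists (c * a), (c * b); split; [apply: idealMl | ring].
Qed.

Lemma sub_adjoin I x a : I a -> adjoin I x a.
Proof. by move=> Ia; exists a, 0; split=> //; ring. Qed.

Lemma mem_adjoin I x : ideal I -> adjoin I x x.
Proof. by move=> iI; exists 0, 1; split; [apply: ideal0 | ring]. Qed.

(** If no member were maximal, a choice of strictly larger members would build an
    increasing sequence; its union is finitely generated, hence one of its terms. *)
Lemma noetherian_max (F : set R -> Prop) :
  noetherian R -> (forall I, F I -> ideal I) -> (exists I, F I) ->
  exists I, F I /\ forall J, F J -> (forall x, I x -> J x) -> forall x, J x -> I x.
Proof.
move=> noeth Fi [I0 FI0]; apply: contrapT => nomax.
have step (I : {I | F I}) : exists J : {I | F I},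
    (forall x, sval I x -> sval J x) /\ exists x, sval J x /\ ~ sval I x.
  case: I => I FI; apply: contrapT => noJ; apply: nomax; exists I; split=> // J FJ IJ x Jx.
  by apply: contrapT => nIx; apply: noJ; exists (exist _ J FJ); split=> //; exists x.
have [s sP] := choice step.
pose A n : {I | F I} := iter n s (exist _ I0 FI0).
have Amono n k x : (n <= k)%N -> sval (A n) x -> sval (A k) x.
  move=> /subnK <-; elim: (k - n)%N => // j IHj /IHj.
  by rewrite addSn; case: (sP (A (j + n)%N)) => + _; apply.
have Ai n : ideal (sval (A n)) by apply: Fi; apply: proj2_sig.
pose U : set R := fun x => exists n, sval (A n) x.
have Ui : ideal U.
  split=> [|x y [i Ax] [j Ay]|a x [i Ax]]; first by exists 0; apply: ideal0.
    exists (maxn i j); apply: idealD => //.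
      by apply: Amono Ax; rewrite leq_maxl.
    by apply: Amono Ay; rewrite leq_maxr.
  by exists i; apply: idealMl.
have [n [g gU]] := noeth U Ui.
have gin i : U (g i).
  rewrite gU; exists (fun j => if j == i then 1 else 0).
  rewrite (bigD1 i) //= eqxx mul1r big1 ?addr0 // => j /negPf ->.
  by rewrite mul0r.
have [N Ng] := choice gin.
have [_ [x [Ax nAx]]] := sP (A (\max_(i < n) N i)); apply: nAx.
have : U x by exists (\max_(i < n) N i).+1.
rewrite gU => -[a ->]; apply: ideal_sum => // i; apply: idealMl => //.
by apply: Amono (Ng i); apply: leq_bigmax.
Qed.

(** [P]-saturated ideals: the contractions of the ideals of the localization at [P].
    Working with them inside [R] replaces localizing. *)
Definition saturated P I := ideal I /\ forall s r, ~ P s -> I (s * r) -> I r.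

Definition saturation P I : set R := fun r => exists s, ~ P s /\ I (s * r).

Lemma saturated_saturation P I : prime_ideal P -> ideal I -> saturated P (saturation P I).
Proof.
move=> [_ P1 Pprime] iI; split; first split.
- by exists 1; split=> //; rewrite mulr0; apply: ideal0.
- move=> x y [s [Ps Isx]] [t [Pt Ity]]; exists (s * t).
  split; first by case/Pprime.
  rewrite mulrDr; apply: idealD => //.
    by rewrite (mulrC s) -mulrA; apply: idealMl.
  by rewrite -mulrA; apply: idealMl.
- move=> a x [s [Ps Isx]]; exists s; split=> //.
  by rewrite mulrCA; apply: idealMl.
- move=> s r Ps [t [Pt Itsr]]; exists (t * s); rewrite -mulrA; split=> //.
  by case/Pprime.
Qed.

Lemma sub_saturation P I x : prime_ideal P -> I x -> saturation P I x.
Proof. by move=> [_ P1 _] Ix; exists 1; rewrite mul1r. Qed.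

Lemma prime_saturated P p : prime_ideal p -> (forall x, p x -> P x) -> saturated P p.
Proof.
move=> [ip p1 pprime] pP; split=> // s r Ps /pprime [/pP//|//].
Qed.

Lemma saturated_sub P q I : (forall x, q x -> P x) -> saturated q I -> saturated P I.
Proof. by move=> qP [iI sI]; split=> // s r Ps; apply: sI => /qP. Qed.

(** Nakayama's lemma for an [I] that is generated by [J] and [P I] over the
    localization at [P]: the hypothesis says that every saturated ideal containing both
    contains [I].  A saturated [K] maximal among those that contain [J] but not [I]
    satisfies [P I <= K], because for [x] in [I] and [a] in [P] the relation
    [s x = k + b a x] has the coefficient [s - b a] outside [P]. *)
Lemma saturated_nakayama P I J : noetherian R -> prime_ideal P -> saturated P J ->
  (forall K, saturated P K -> (forall x, J x -> K x) ->
     (forall a x, P a -> I x -> K (a * x)) -> forall x, I x -> K x) ->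
  forall x, I x -> J x.
Proof.
move=> noeth Pp Jsat IP; apply: contrapT => nIJ.
have [||K [[Ksat JK nIK] Kmax]] := @noetherian_max
  (fun K => [/\ saturated P K, forall x, J x -> K x & ~ forall x, I x -> K x]) noeth.
- by move=> K [[]].
- by exists J.
have iK := proj1 Ksat; apply: nIK; apply: IP => // a x Pa Ix.
apply: contrapT => nKax.
pose K' := saturation P (adjoin K (a * x)).
have K'sat : saturated P K' by apply: saturated_saturation => //; apply: ideal_adjoin.
have KK' y : K y -> K' y by move=> Ky; apply: sub_saturation => //; apply: sub_adjoin.
have [IK'|nIK'] := pselect (forall x, I x -> K' x); last first.
  apply: nKax; apply: (Kmax K') => //; first by split=> // y /JK /KK'.
  by apply: sub_saturation => //; apply: mem_adjoin.
have [s [Ps [k [b [Kk e]]]]] := IK' x Ix.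
apply: nKax; apply: idealMl => //; apply: ((proj2 Ksat) (s - b * a)).
  move=> Psba; apply: Ps; rewrite -(subrK (b * a) s); have iP := prime_idealP Pp.
  by apply: idealD => //; apply: idealMl.
by rewrite mulrBl e -mulrA addrK.
Qed.

(** When [P] is minimal over [K0], the localization of [R / K0] at [P] is Artinian;
    this is the descending chain condition for its ideals.  It is proved by
    climbing from [K0] to [R]: if the chain stabilizes on [K], it stabilizes on
    [K + R g] for any [g] with [P g <= K], and such a [g] exists because an
    annihilator of maximal size is prime. *)
Lemma saturated_dcc P K0 (J : nat -> set R) : noetherian R -> prime_ideal P -> ideal K0 ->
  (forall p, prime_ideal p -> (forall x, K0 x -> p x) -> (forall x, p x -> P x) ->
     forall x, P x -> p x) ->
  (forall n, saturated P (J n)) -> (forall n x, K0 x -> J n x) ->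
  (forall n k x, (n <= k)%N -> J k x -> J n x) ->
  exists n, forall x, J n x -> J n.+1 x.
Proof.
move=> noeth Pp iK0 Pmin Jsat K0J Jmono.
have iP := prime_idealP Pp; have iJ n := proj1 (Jsat n).
pose T K := exists n, forall k x, (n <= k)%N -> K x -> J n x -> J k x.
have [||K [[Ksat K0K [n0 KT]] Kmax]] := @noetherian_max
  (fun K => [/\ saturated P K, forall x, K0 x -> K x & T K]) noeth.
- by move=> K [[]].
- exists (saturation P K0); split.
  + exact: saturated_saturation.
  + by move=> x; apply: sub_saturation.
  + exists 0%N => k x _ [s [Ps K0x]] _; apply: ((proj2 (Jsat k)) s) => //.
    exact: K0J.
have iK := proj1 Ksat.
have [K1|K1] := pselect (K 1).
  by exists n0 => x; apply: KT => //; rewrite -(mulr1 x); apply: idealMl.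
pose colon g : set R := fun a => K (a * g).
have icolon g : ideal (colon g).
  split=> [|x y|a x]; rewrite /colon ?mul0r ?mulrDl -?mulrA.
  - exact: ideal0.
  - exact: idealD.
  - exact: idealMl.
have [||I [[g [nKg Ig]] gmax]] := @noetherian_max
  (fun I => exists g, ~ K g /\ I = colon g) noeth.
- by move=> _ [g [_ ->]].
- by exists (colon 1), 1.
move: gmax; rewrite {}Ig => gmax.
have gprime : prime_ideal (colon g).
  split=> //; first by rewrite /colon mul1r.
  move=> a b abg; have [bg|nbg] := pselect (colon g b); [by right | left].
  apply: (gmax (colon (b * g))); first by exists (b * g).
    by move=> x xg; rewrite /colon mulrCA; apply: idealMl.
  by rewrite /colon mulrA.
(* the prime (K : g) lies between K0 and P, so it is P *)
have Pg : forall x, P x -> colon g x.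
  apply: Pmin => //; first by move=> x /K0K Kx; apply: idealMr.
  by move=> x xg; apply: contrapT => nPx; apply: nKg; apply: (proj2 Ksat) xg.
pose K' := saturation P (adjoin K g).
have K'sat : saturated P K' by apply: saturated_saturation => //; apply: ideal_adjoin.
have KK' y : K y -> K' y by move=> Ky; apply: sub_saturation => //; apply: sub_adjoin.
exfalso; apply: nKg; apply: (Kmax K') => //; last first.
  by apply: sub_saturation => //; apply: mem_adjoin.
split=> //; first by move=> x /K0K /KK'.
(* K' / K is simple over the localization: the chain meets it in 0 from some point
   on, or it always contains an element outside K, which then generates K' mod K *)
have [[n1 n1P]|nbig] := pselect (exists n1, forall r, K' r -> J n1 r -> K r).
  exists (maxn n0 n1) => k x; rewrite geq_max => /andP[n0k n1k] K'x Jx.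
  apply: KT => //.
    by apply: n1P => //; apply: Jmono Jx; rewrite leq_maxr.
  by apply: Jmono Jx; rewrite leq_maxl.
exists n0 => k z n0k [t [Pt [k' [b [Kk' tz]]]]] Jz.
have [r [K'r Jr nKr]] : exists r, [/\ K' r, J k r & ~ K r].
  apply: contrapT => no; apply: nbig; exists k => r K'r Jr.
  by apply: contrapT => nKr; apply: no; exists r.
have [s [Ps [c [a [Kc sr]]]]] := K'r.
have Pa : ~ P a.
  move=> /Pg ag; apply: nKr; apply: ((proj2 Ksat) s) => //.
  by rewrite sr; apply: idealD.
have Pat : ~ P (a * t) by case: Pp => _ _ prod /prod[].
apply: ((proj2 (Jsat k)) (a * t)) => //.
have -> : a * t * z = (a * t * z - b * s * r) + b * s * r by ring.
apply: idealD => //; last exact: idealMl.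
apply: KT => //; last first.
  apply: idealB; [exact: iJ|exact: idealMl|apply: idealMl => //].
  exact: Jmono Jr.
have -> : a * t * z - b * s * r = a * k' - b * c.
  by rewrite -!mulrA tz sr; ring.
by apply: idealB => //; apply: idealMl.
Qed.

(** The symbolic powers of [q / p]: [symb_pow p q n.+1] is the least [q]-saturated
    ideal that contains [p] and the product of [q] with [symb_pow p q n]. *)
Fixpoint symb_pow p q n : set R :=
  if n is n'.+1 then
    fun x => forall K, saturated q K -> (forall y, p y -> K y) ->
      (forall a y, q a -> symb_pow p q n' y -> K (a * y)) -> K x
  else fun _ => True.

Section SymbolicPowers.
Context (p q : set R) (pp : prime_ideal p) (qp : prime_ideal q).
Context (pq : forall x, p x -> q x).

Lemma symb_pow_saturated n : saturated q (symb_pow p q n).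
Proof.
case: n => [|n]; first by [].
split; first split.
- by move=> K [iK _] _ _; apply: ideal0.
- move=> x y Kx Ky K sK pK qK; apply: idealD (Kx K sK pK qK) (Ky K sK pK qK).
  by case: sK.
- by move=> a x Kx K sK pK qK; apply: idealMl (Kx K sK pK qK); case: sK.
- move=> s r Ps Ksr K sK pK qK; case: (sK) => _; apply; first exact: Ps.
  exact: Ksr.
Qed.

Lemma symb_pow_sub n x : p x -> symb_pow p q n x.
Proof. by case: n => //= n px K _ pK _; apply: pK. Qed.

Lemma symb_powS n x : symb_pow p q n.+1 x -> symb_pow p q n x.
Proof.
move=> /(_ (symb_pow p q n)); apply; first exact: symb_pow_saturated.
  exact: symb_pow_sub.
by move=> a y _; apply: idealMl; case: (symb_pow_saturated n).
Qed.

Lemma symb_pow_mono n k x : (n <= k)%N -> symb_pow p q k x -> symb_pow p q n x.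
Proof. by move=> /subnK <-; elim: (k - n)%N => // j IHj; rewrite addSn => /symb_powS. Qed.

Lemma symb_pow_exp n a : q a -> symb_pow p q n (a ^+ n).
Proof.
by move=> qa; elim: n => // n IHn K _ _; rewrite exprS; apply.
Qed.

End SymbolicPowers.

(** Krull's principal ideal theorem, in the form: [P] has height at least 2 over
    [p], so it is not minimal over [p + (x)].  Otherwise the descending chain
    condition modulo [x] gives [q^(n) <= q^(n+1) + (x)] locally at [P] for the
    symbolic powers; as [x] is outside [q], even [q^(n) <= q^(n+1) + x q^(n)].
    Nakayama at [P] gives [q^(n) = q^(n+1)], and Nakayama at [q] gives
    [q^(n) <= p], which forces [q <= p]. *)
Lemma krull_hauptidealsatz p q P x : noetherian R ->
  prime_ideal p -> prime_ideal q -> prime_ideal P ->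
  (p `<` q)%classic -> (q `<` P)%classic -> P x -> ~ q x ->
  exists p', [/\ prime_ideal p', (p `<` p')%classic, (p' `<` P)%classic & p' x].
Proof.
move=> noeth pp qp Pp [pq pneq] [qP _] Px nqx.
have [ip iq iP] := And3 (prime_idealP pp) (prime_idealP qp) (prime_idealP Pp).
apply: contrapT => no.
have Pmin p' : prime_ideal p' -> (forall y, adjoin p x y -> p' y) ->
    (forall y, p' y -> P y) -> forall y, P y -> p' y.
  move=> p'p pxp' p'P; apply: contrapT => Pp'; apply: no; exists p'.
  have p'x : p' x by apply/pxp'/mem_adjoin.
  split=> //; split=> //; first by move=> y py; apply/pxp'/sub_adjoin.
  by move=> /(_ x p'x) /pq.
pose J n := saturation P (adjoin (symb_pow p q n) x).
have isp n := proj1 (symb_pow_saturated p q n).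
have [|||||n Jn] := @saturated_dcc P (adjoin p x) J noeth Pp.
- exact: ideal_adjoin.
- exact: Pmin.
- by move=> n; apply: saturated_saturation => //; apply: ideal_adjoin.
- move=> n y [a [b [pa ->]]]; apply: sub_saturation => //.
  by exists a, b; split=> //; apply: symb_pow_sub.
- move=> n k y nk [s [Ps [a [b [pa e]]]]]; exists s; split=> //.
  by exists a, b; split=> //; apply: symb_pow_mono pa.
have sn : forall y, symb_pow p q n y -> symb_pow p q n.+1 y.
  apply: (saturated_nakayama noeth Pp).
    by apply: saturated_sub (symb_pow_saturated p q _).
  move=> K [iK sK] JK PK y qy.
  have [s [Ps [b [c [qb sy]]]]] : J n.+1 y.
    by apply: Jn; apply: sub_saturation => //; apply: sub_adjoin.
  apply: (sK s) => //; rewrite sy; apply: idealD => //; first exact: JK.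
  rewrite mulrC; apply: PK => //; have [_ sq] := symb_pow_saturated p q n.
  apply: (sq x) => //; rewrite mulrC -(addKr b (c * x)) -sy.
  by apply: idealD => //; [apply: idealN => //; apply: symb_powS | apply: idealMl].
have sp : forall y, symb_pow p q n y -> p y.
  apply: (saturated_nakayama noeth qp); first exact: prime_saturated.
  by move=> K sK pK qK y /sn; apply.
apply: pneq => y qy; have := sp _ (symb_pow_exp p n qy).
case: pp => _ p1 pprime; elim: n {Jn sn sp} => [|n IHn]; first by move/p1.
by rewrite exprS => /pprime[|/IHn].
Qed.

End Ideals.

(** * Regular sequences in regular local rings *)

Section LocalDimension.
Context (R : comPzRingType) (m : set R).
Context (noeth : noetherian R) (loc : local_ring m).
Implicit Types (I J : set R).

Lemma sub_maximal J : ideal J -> ~ J 1 -> forall x, J x -> m x.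
Proof.
move=> iJ J1; have [||K [[iK K1 JK] Kmax]] := @noetherian_max R
  (fun K => [/\ ideal K, ~ K 1 & forall x, J x -> K x]) noeth.
- by move=> K [].
- by exists J.
case: loc => _ uniq; rewrite -(uniq K) //; split=> // L iL L1 KL.
rewrite eqEsubset; split=> //; apply: Kmax => //; split=> // x /JK; exact: KL.
Qed.

Lemma local_maximal : maximal_ideal m. Proof. by case: loc. Qed.
Lemma ideal_m : ideal m. Proof. by case: local_maximal. Qed.
Lemma maximal_proper : ~ m 1. Proof. by case: local_maximal. Qed.

Lemma unit_of_notin a : ~ m a -> exists b, b * a = 1.
Proof.
move=> ma; apply: contrapT => nob; apply: ma.
have i0 : ideal (fun x : R => x = 0).
  by split=> // [x y -> ->|b x ->]; rewrite ?addr0 ?mulr0.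
apply: (@sub_maximal (adjoin (fun x => x = 0) a)).
- exact: ideal_adjoin.
- by move=> [_ [b [-> e]]]; apply: nob; exists b; rewrite e add0r.
- exact: mem_adjoin.
Qed.

Lemma prime_m : prime_ideal m.
Proof.
have im := ideal_m; split=> //; first exact: maximal_proper.
move=> x y mxy; have [|/unit_of_notin [b bx]] := pselect (m x); [by left|right].
by rewrite -(mul1r y) -bx -mulrA; apply: idealMl.
Qed.

Lemma prime_sub_m P : prime_ideal P -> forall x, P x -> m x.
Proof. by move=> [iP P1 _]; apply: sub_maximal. Qed.

Lemma prime_chain_le n (P : nat -> set R) i j x :
  prime_chain n P -> (i <= j <= n)%N -> P i x -> P j x.
Proof.
move=> [_ Plt] /andP[/subnK <-]; elim: (j - i)%N => // k IHk kn Px.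
rewrite addSn; have [s _] := Plt (k + i)%N kn; apply: s; apply: IHk => //.
exact: ltnW.
Qed.

(** The principal ideal theorem moves the first occurrence of [x] in a chain one
    step down, as long as two members lie below it. *)
Lemma prime_chain_at n (P : nat -> set R) x i :
  prime_chain n P -> (0 < i <= n)%N -> P i x ->
  exists P', [/\ prime_chain n P', P' 0%N = P 0%N & P' 1%N x].
Proof.
elim: i P => // i IHi P [Ppr Plt] /= i_n Px; case: i IHi i_n Px => [|i] IHi i_n Px.
  by exists P.
have [Pix|nPix] := pselect (P i.+1 x); first by apply: IHi => //; apply: ltnW.
have [p' [p'pr lt1 lt2 p'x]] := krull_hauptidealsatz noeth
  (Ppr i (ltnW (ltnW i_n))) (Ppr i.+1 (ltnW i_n)) (Ppr i.+2 i_n)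
  (Plt i (ltnW i_n)) (Plt i.+1 i_n) Px nPix.
have [|||P' [? P'0 ?]] := IHi (fun j => if j == i.+1 then p' else P j).
- split=> j j_n; first by case: eqP => // _; apply: Ppr.
  case: eqP => [->|ji]; first by rewrite ifN ?gtn_eqF.
  by rewrite eqSS; case: eqP => [->|_] //; apply: Plt.
- by rewrite /= ltnW.
- by rewrite eqxx.
- by exists P'; split.
Qed.

(** The last member of the chain may be replaced by [m], which contains [x]. *)
Lemma prime_chain_through n (P : nat -> set R) x :
  prime_chain n.+1 P -> m x ->
  exists P', [/\ prime_chain n.+1 P', P' 0%N = P 0%N & P' 1%N x].
Proof.
move=> Pch mx; have [Ppr Plt] := Pch.
pose P1 j := if j == n.+1 then m else P j.
have P1ch : prime_chain n.+1 P1.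
  split=> j j_n; rewrite /P1; first by case: eqP => // _; [apply: prime_m|apply: Ppr].
  rewrite ltn_eqF // eqSS; case: eqP => [jn|_]; last exact: Plt.
  rewrite {}jn {j j_n}; have [s ns] := Plt n (ltnSn n).
  have Pm y := @prime_sub_m (P n.+1) (Ppr _ (leqnn _)) y.
  by split=> [y /s /Pm|mP] //; apply: ns => y /Pm /mP.
have [||P' [P'ch P'0 P'x]] := @prime_chain_at n.+1 P1 x n.+1 P1ch.
- by rewrite /= leqnn.
- by rewrite /P1 eqxx.
by exists P'; split.
Qed.

Lemma prime_chain_behead n (P : nat -> set R) :
  prime_chain n.+1 P -> prime_chain n (fun i => P i.+1).
Proof. by move=> [Ppr Plt]; split=> i ?; [apply: Ppr | apply: Plt]. Qed.

End LocalDimension.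

Section RegularSequences.

(** The ideal generated by [x 0], ..., [x (j - 1)]. *)
Fixpoint partial_ideal (R : pzRingType) (x : nat -> R) j : set R :=
  if j is j'.+1 then fun z => exists a b, partial_ideal x j' a /\ z = a + b * x j'
  else fun z => z = 0.

Context (R : comPzRingType) (m : set R) (x : nat -> R) (d : nat).
Context (noeth : noetherian R) (loc : local_ring m).
Context (mE : m = partial_ideal x d).
Implicit Types (P : nat -> set R).

Lemma ideal_partial j : ideal (partial_ideal x j).
Proof.
elim: j => [|j]; last exact: ideal_adjoin.
by split=> // [y z -> ->|b y ->]; rewrite ?addr0 ?mulr0.
Qed.

Lemma partial_ideal_sub j k y : (j <= k)%N -> partial_ideal x j y -> partial_ideal x k y.
Proof.
move=> /subnK <-; elim: (k - j)%N => // i IHi Iy.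
by exists y, 0; rewrite mul0r addr0; split=> //; apply: IHi.
Qed.

Lemma partial_ideal_gen j k : (j < k)%N -> partial_ideal x k (x j).
Proof.
move=> jk; apply: (partial_ideal_sub jk); apply: mem_adjoin; exact: ideal_partial.
Qed.

(** Reroute the chain through [x k]; without its first member it lies above the
    next partial ideal. *)
Lemma prime_chain_bound e k n P : (k + e)%N = d -> prime_chain n P ->
  (forall y, partial_ideal x k y -> P 0%N y) -> (n <= e)%N.
Proof.
elim: e k n P => [|e IHe] k [//|n] P kd Pch IP.
  rewrite addn0 in kd; have [Ppr Plt] := Pch; have [_ []] := Plt 0%N (ltn0Sn n).
  move=> y /(prime_sub_m noeth loc (Ppr _ (ltn0Sn n))).
  by rewrite mE -kd; apply: IP.
have mx : m (x k) by rewrite mE; apply: partial_ideal_gen; lia.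
have [P' [P'ch P'0 P'x]] := prime_chain_through noeth loc Pch mx.
apply: (IHe k.+1 n _ _ (prime_chain_behead P'ch)); first by rewrite addSnnS.
move=> _ [a [b [Ia ->]]]; have [/(_ 1%N (ltn0Sn n)) [iP' _ _] _] := P'ch.
apply: idealD => //; last exact: idealMl.
by apply: (prime_chain_le P'ch (i := 0)) => //; rewrite P'0; apply: IP.
Qed.

(** After rerouting through [x k], induction identifies the second member of the
    chain with the next partial ideal [I + (x k)].  The first member [P 0] lies in
    it and does not contain [x k] (otherwise the whole chain would lie above
    [I + (x k)], against the bound), so [P 0 <= I + x k P 0] and [P 0 = I] by
    Nakayama's lemma.  Hence all partial ideals from the [k]-th on are prime. *)
Lemma partial_ideal_regular e k P : (k + e)%N = d -> prime_chain e P ->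
  (forall y, partial_ideal x k y -> P 0%N y) ->
  [/\ forall y, P 0%N y -> partial_ideal x k y,
      forall j, (k <= j <= d)%N -> prime_ideal (partial_ideal x j) &
      forall j, (k <= j < d)%N -> ~ partial_ideal x j (x j)].
Proof.
elim: e k P => [|e IHe] k P kd Pch IP.
  have kd' : k = d by lia.
  have mI : m = partial_ideal x k by rewrite kd'.
  have [Ppr _] := Pch; split.
  - by move=> y /(prime_sub_m noeth loc (Ppr _ (leqnn _))); rewrite mI.
  - move=> j jk; have -> : j = k by lia.
    by rewrite -mI; apply: (prime_m noeth).
  - by move=> j jk; exfalso; lia.
have mx : m (x k) by rewrite mE; apply: partial_ideal_gen; lia.
have [P' [P'ch P'0 P'x]] := prime_chain_through noeth loc Pch mx.
have [P'pr _] := P'ch; have iP' := prime_idealP (P'pr 1%N (ltn0Sn e)).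
have sP0 y : P 0%N y -> P' 1%N y.
  by rewrite -P'0 => ?; apply: (prime_chain_le P'ch (i := 0)).
have kd' : (k.+1 + e)%N = d by rewrite addSnnS.
have [|P'I Ipr Ix] := IHe k.+1 _ kd' (prime_chain_behead P'ch).
  move=> _ [a [b [Ia ->]]]; apply: idealD => //; last exact: idealMl.
  exact/sP0/IP.
have [P0i _ P0prime] := proj1 Pch 0%N (leq0n _).
have P0x : ~ P 0%N (x k).
  move=> P0x; have : (e.+1 <= e)%N; last by rewrite ltnn.
  apply: (prime_chain_bound kd' Pch) => _ [a [b [Ia ->]]].
  by apply: idealD => //; [apply: IP | apply: idealMl].
have P0I y : P 0%N y -> partial_ideal x k y.
  apply: (saturated_nakayama noeth (prime_m noeth loc)).
    split; first exact: ideal_partial.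
    move=> s r /(unit_of_notin noeth loc) [b bs] Isr.
    by rewrite -(mul1r r) -bs -mulrA; apply: idealMl (ideal_partial k) Isr.
  move=> K [iK _] IK mK z Pz; have [a [b [Ia zE]]] := P'I _ (sP0 _ Pz).
  rewrite zE; apply: idealD => //; first exact: IK.
  rewrite mulrC; apply: mK => //.
  have : P 0%N (b * x k).
    by rewrite -(addKr a (b * _)) -zE; apply: idealD => //; apply: idealN => //; apply: IP.
  by case/P0prime.
have PI : P 0%N = partial_ideal x k by rewrite eqEsubset; split.
split=> // j /andP[].
  rewrite leq_eqVlt => /predU1P[<- _|kj jd]; last by apply: Ipr; rewrite kj.
  by rewrite -PI; apply: (proj1 Pch).
rewrite leq_eqVlt => /predU1P[<- _|kj jd]; last by apply: Ix; rewrite kj.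
by rewrite -PI.
Qed.

End RegularSequences.

(** The generators of [m], as many as the dimension, form a regular sequence:
    each [x j] lies outside the prime ideal generated by its predecessors. *)
Theorem regular_local_sequence (R : comPzRingType) (m : set R) :
  regular_local m -> exists (d : nat) (x : nat -> R),
    m = partial_ideal x d /\
    forall j c, (j < d)%N -> partial_ideal x j (c * x j) -> partial_ideal x j c.
Proof.
move=> [_ noeth loc [d [[[P Pch] _] [[g mg] _]]]].
exists d, (fun j => if insub j is Some i then g i else 0); set x := fun _ => _.
have mE : m = partial_ideal x d.
  rewrite mg eqEsubset; split=> y.
    move=> [a ->]; have id := ideal_partial x d.
    apply: ideal_sum => // i; apply: idealMl => //.
    have -> : g i = x i by rewrite /x valK.
    exact: partial_ideal_gen.
  have im := ideal_m loc; move=> Iy.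
  have : forall j, (j <= d)%N -> forall z, partial_ideal x j z -> m z.
    elim=> [_ _ ->|j IHj jd _ [a [b [Ia ->]]]]; first exact: ideal0.
    apply: idealD => //; first exact: IHj (ltnW jd) _ Ia.
    apply: idealMl => //; rewrite /x insubT mg.
    exists (fun k => if k == Sub j jd then 1 else 0).
    by rewrite (bigD1 (Sub j jd)) //= eqxx mul1r big1 ?addr0 // => k /negPf ->; rewrite mul0r.
  by rewrite -mg => /(_ d (leqnn d) y Iy).
split=> // j c jd.
have [|_ Ipr Ix] := partial_ideal_regular (x := x) noeth loc mE (add0n d) Pch.
  by move=> _ ->; apply: ideal0; apply: prime_idealP; apply: (proj1 Pch).
have [_ _ pr] := Ipr j (ltnW jd); case/pr => // /Ix []; exact: jd.
Qed.

(** * Minimal generators, Nakayama's lemma and Hom modules *)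

Section Generators.
Context (S : pzRingType) (V : lmodType S) (J : S -> Prop).

(** A relation with an invertible coefficient makes a generator superfluous. *)
Lemma minimal_generators n (v : 'I_n -> V) :
  (forall a, J a \/ exists b, b * a = 1) ->
  exists r (w : 'I_r -> V),
    (forall y, (exists a : 'I_n -> S, y = \sum_i a i *: v i) <->
               (exists a : 'I_r -> S, y = \sum_i a i *: w i)) /\
    forall a : 'I_r -> S, \sum_i a i *: w i = 0 -> forall i, J (a i).
Proof.
move=> unitJ; elim: n v => [|n IHn] v; first by exists 0%N, v; split=> // a _ [].
have [relJ|] := pselect (forall a, \sum_i a i *: v i = 0 -> forall i, J (a i)).
  by exists n.+1, v.
move=> /existsNP [a] /not_implyP [a0 /existsNP [k nJ]].
have [//|[b bak]] := unitJ (a k).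
have vk : v k = \sum_j (- (b * a (lift k j))) *: v (lift k j).
  move: a0; rewrite (bigD1_ord k) //= => /(congr1 (fun y => b *: y)).
  rewrite scaler0 scalerDr scalerA bak scale1r => /eqP.
  rewrite addr_eq0 => /eqP ->; rewrite scaler_sumr -sumrN; apply: eq_bigr => j _.
  by rewrite scaleNr scalerA.
have [r [w [wv wJ]]] := IHn (fun j => v (lift k j)).
exists r, w; split=> // y; rewrite -wv; split=> -[c ->].
  exists (fun j => c (lift k j) - c k * (b * a (lift k j))).
  rewrite (bigD1_ord k) //= vk scaler_sumr -big_split /=; apply: eq_bigr => j _.
  by rewrite scalerBl scaleNr scalerN scalerA addrC.
exists (fun i => if unlift k i is Some j then c j else 0).
rewrite [RHS](bigD1_ord k) //= unlift_none scale0r add0r.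
by apply: eq_bigr => j _; rewrite liftK.
Qed.

(** Nakayama's lemma in terms of generators, by Gaussian elimination: the first
    relation expresses [v ord0] through the other generators, since [1 - a ord0 ord0]
    is invertible. *)
Lemma nakayama n (v : 'I_n -> V) (a : 'I_n -> 'I_n -> S) :
  (forall b c, J b -> J c -> J (b + c)) -> (forall b c, J c -> J (b * c)) ->
  (forall b, J b -> exists u, u * (1 - b) = 1) ->
  (forall i j, J (a i j)) -> (forall i, v i = \sum_j a i j *: v j) ->
  forall i, v i = 0.
Proof.
move=> JD JM Junit; elim: n v a => [|n IHn] v a Ja va; first by case.
have [u u1] := Junit _ (Ja ord0 ord0).
have v0 : v ord0 = \sum_(j < n) (u * a ord0 (lift ord0 j)) *: v (lift ord0 j).
  have e : (1 - a ord0 ord0) *: v ord0 = \sum_(j < n) a ord0 (lift ord0 j) *: v (lift ord0 j).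
    rewrite scalerBl scale1r; apply/eqP; rewrite subr_eq addrC; apply/eqP.
    by rewrite {1}va big_ord_recl.
  rewrite -[LHS]scale1r -u1 -scalerA e scaler_sumr.
  by apply: eq_bigr => j _; rewrite scalerA.
have vS : forall i, v (lift ord0 i) = 0.
  apply: (IHn _ (fun i j => a (lift ord0 i) ord0 * (u * a ord0 (lift ord0 j)) +
                            a (lift ord0 i) (lift ord0 j))) => [i j|i].
    by apply: JD; [apply/JM/JM | ].
  rewrite {1}va big_ord_recl v0 scaler_sumr -big_split; apply: eq_bigr => j _ /=.
  by rewrite scalerDl scalerA.
move=> i; have [j ->|->] := unliftP ord0 i; first exact: vS.
by rewrite v0 big1 // => j _; rewrite vS scaler0.
Qed.

End Generators.

(** [Hom(M, X)] as a right module over the endomorphism ring of [M], acting by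
    precomposition. *)
Section HomModule.
Context (C : preaddCat) (M X : C).

Definition hmod : Type := hom M X.
HB.instance Definition _ := GRing.Zmodule.on hmod.

Definition hmod_scale (a : (endo M)^c) (w : hmod) : hmod :=
  (w : hom M X) ∘ (a : hom M M).

Lemma hmod_scaleA a b w : hmod_scale a (hmod_scale b w) = hmod_scale (a * b) w.
Proof. exact: esym (compA _ _ _). Qed.
Lemma hmod_scale1 : left_id 1 hmod_scale.
Proof. exact: compm1. Qed.
Lemma hmod_scaleDr : right_distributive hmod_scale +%R.
Proof. by move=> a v w; apply: compDl. Qed.
Lemma hmod_scaleDl w : {morph hmod_scale^~ w : a b / a + b >-> a + b}.
Proof. by move=> a b; apply: compDr. Qed.

HB.instance Definition _ := GRing.Zmodule_isLmodule.Build (endo M)^c hmod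
  hmod_scaleA hmod_scale1 hmod_scaleDr hmod_scaleDl.

Lemma hmod_scaleE (a : (endo M)^c) (w : hmod) :
  a *: w = (w : hom M X) ∘ (a : hom M M).
Proof. by []. Qed.

End HomModule.

Section Biproducts.
Context (C : addCat).

Lemma bip_ext (W Y Z : C) (v w : hom W (bip Y Z)) :
  prj1 ∘ v = prj1 ∘ w -> prj2 ∘ v = prj2 ∘ w -> v = w.
Proof.
by move=> e1 e2; rewrite -[v]comp1m -[w]comp1m -bip_id !compDl -!compA e1 e2.
Qed.

Lemma prj1_pair (W Y Z : C) (v : hom W Y) (w : hom W Z) :
  prj1 ∘ (inj1 ∘ v + inj2 ∘ w) = v.
Proof. by rewrite compDr !compA prj1_inj1 prj1_inj2 comp1m comp0m addr0. Qed.

Lemma prj2_pair (W Y Z : C) (v : hom W Y) (w : hom W Z) :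
  prj2 ∘ (inj1 ∘ v + inj2 ∘ w) = w.
Proof. by rewrite compDr !compA prj2_inj1 prj2_inj2 comp1m comp0m add0r. Qed.

End Biproducts.

Section AddClosure.
Context (C : addCat) (M : C).

Lemma copies_basis n : exists (e : 'I_n -> hom M (copies M n)) (f : 'I_n -> hom (copies M n) M),
  (forall k l, f k ∘ e l = if k == l then idm M else 0) /\
  \sum_k e k ∘ f k = idm (copies M n).
Proof.
elim: n => [|n [e [f [fe ef]]]].
  exists (fun=> 0), (fun=> 0); split; first by case.
  by rewrite big_ord0 /= (to_zobj (idm (zobj C))).
exists (fun k => if unlift ord0 k is Some j then inj2 ∘ e j else inj1),
       (fun k => if unlift ord0 k is Some j then f j ∘ prj2 else prj1); split.
  move=> k l; have [j ->|->] := unliftP ord0 k; have [i ->|->] := unliftP ord0 l.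
  - rewrite (inj_eq lift_inj) -fe -compA (compA prj2) prj2_inj2 comp1m; by [].
  - by rewrite -compA prj2_inj1 compm0.
  - by rewrite compA prj1_inj2 comp0m.
  - by rewrite prj1_inj1.
rewrite big_ord_recl unlift_none /= -bip_id; congr (_ + _).
rewrite -[in RHS](comp1m prj2) -ef comp_suml comp_sumr.
by apply: eq_bigr => k _; rewrite liftK !compA.
Qed.

(** Objects of [add M] are projective with respect to [Hom(M, -)]: [f] is lifted
    along a dual basis of [X]. *)
Lemma add_lift (X Y Z : C) (f : hom X Y) (g : hom Z Y) : in_add M X ->
  (forall w : hom M X, exists z, f ∘ w = g ∘ z) -> exists h, f = g ∘ h.
Proof.
move=> /add_dual_basis [n [x [y xy]]] fg.
have [z zE] := choice (fun k => fg (x k)).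
exists (\sum_k z k ∘ y k); rewrite -[LHS]compm1 -xy !comp_sumr.
by apply: eq_bigr => k _; rewrite !compA zE.
Qed.

Lemma add_faithful (X Y : C) (f g : hom X Y) : in_add M X ->
  (forall w : hom M X, f ∘ w = g ∘ w) -> f = g.
Proof.
move=> /add_dual_basis [n [x [y xy]]] fg.
rewrite -[f]compm1 -[g]compm1 -xy !comp_sumr.
by apply: eq_bigr => k _; rewrite !compA fg.
Qed.

End AddClosure.

(** * Purity along a regular sequence *)

Section Purity.
Context (C : addCat) (M : C) (addM : forall X : C, in_add M X).
Context (comm : forall a b : endo M, a * b = b * a).
Context (x : nat -> endo M) (d : nat).
Context (regx : forall j c, (j < d)%N ->
  partial_ideal x j (c * x j) -> partial_ideal x j c).
Implicit Types X Y Z : C.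

(** [L x_0 + ... + L x_(j-1)] for a submodule [L] of [Hom(M, X)]. *)
Fixpoint seq_span j X (L : hom M X -> Prop) : hom M X -> Prop :=
  if j is j'.+1 then fun v => exists a l, [/\ seq_span j' L a, L l & v = a + l ∘ (x j' : hom M M)]
  else fun v => v = 0.

Lemma seq_span_sub j X (L L' : hom M X -> Prop) v :
  (forall w, L w -> L' w) -> seq_span j L v -> seq_span j L' v.
Proof.
move=> LL'; elim: j v => //= j IHj _ [a [l [/IHj aL /LL' lL ->]]].
by exists a, l.
Qed.

Lemma seq_spanD j X (L : hom M X -> Prop) v w :
  (forall v w, L v -> L w -> L (v + w)) ->
  seq_span j L v -> seq_span j L w -> seq_span j L (v + w).
Proof.
move=> LD; elim: j v w => [_ _ -> ->|j IHj _ _ [a [l [aL lL ->]]] [b [k [bL kL ->]]]] /=.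
  by rewrite addr0.
exists (a + b), (l + k); split; [exact: IHj|exact: LD|].
by rewrite compDl addrACA.
Qed.

Lemma seq_span0 j X (L : hom M X -> Prop) : L 0 -> seq_span j L 0.
Proof.
move=> L0; elim: j => //= j IHj; exists 0, 0; split=> //.
by rewrite comp0m addr0.
Qed.

Definition full X : hom M X -> Prop := fun=> True.

Lemma seq_span_map j X Y (f : hom X Y) (L : hom M X -> Prop) v :
  seq_span j L v -> seq_span j (fun w => exists2 u, L u & w = f ∘ u) (f ∘ v).
Proof.
elim: j v => [_ -> |j IHj _ [a [l [/IHj aL lL ->]]]] /=; first by rewrite compm0.
by exists (f ∘ a), (f ∘ l); split; [| exists l | rewrite compDr compA].
Qed.

Lemma seq_span_full_map j X Y (f : hom X Y) v :
  seq_span j (@full X) v -> seq_span j (@full Y) (f ∘ v).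
Proof. by move=> /(seq_span_map f); apply: seq_span_sub. Qed.

Lemma seq_span_mul j X (v : hom M X) (a : hom M M) :
  seq_span j (@full X) v -> seq_span j (@full X) (v ∘ a).
Proof.
elim: j v => [_ ->|j IHj _ [b [l [/IHj bL lL ->]]]] /=; first by rewrite comp0m.
exists (b ∘ a), (l ∘ a); split=> //.
by rewrite compDl -!compA; congr (_ + _ ∘ _); apply: comm.
Qed.

Lemma seq_span_ideal j (a : hom M M) : seq_span j (@full M) a <-> partial_ideal x j a.
Proof.
elim: j a => //= j IHj a; split.
  by move=> [b [l [/IHj bI _ ->]]]; exists b, l.
by move=> [b [l [/IHj bI ->]]]; exists b, l.
Qed.

(** Coordinates in [I_j] put a vector into [Hom(M, X) I_j]. *)
Lemma seq_span_coord j X n (e : 'I_n -> hom M X) (f : 'I_n -> hom X M) (w : hom M X) :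
  \sum_k e k ∘ f k = idm X -> (forall k, partial_ideal x j (f k ∘ w : endo M)) ->
  seq_span j (@full X) w.
Proof.
move=> ef fw; rewrite -[w]comp1m -ef comp_suml.
elim/big_ind: _ => [|v u|k _]; [exact: seq_span0|exact: seq_spanD|].
by rewrite -compA; apply: seq_span_full_map; apply/seq_span_ideal.
Qed.

(** [Hom(M, X)] is a direct summand of a free module, so it inherits the regular
    sequence of the ring. *)
Lemma hom_regular X j (c : hom M X) : (j < d)%N ->
  seq_span j (@full X) (c ∘ (x j : hom M M)) -> seq_span j (@full X) c.
Proof.
move=> jd cx; have [n [e [f ef]]] := add_dual_basis (addM X).
apply: (seq_span_coord ef) => k; apply: (regx jd); apply/seq_span_ideal.
by have := seq_span_full_map (f k) cx; rewrite compA.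
Qed.

(** Injectivity of [L / L I_j -> Hom(M, X) / Hom(M, X) I_j], where
    [I_j = (x_0, ..., x_(j-1))]. *)
Definition pure j X (L : hom M X -> Prop) :=
  forall v, L v -> seq_span j (@full X) v -> seq_span j L v.

Definition image X Y (f : hom X Y) : hom M Y -> Prop := fun v => exists w, v = f ∘ w.
Definition kernel X Y (f : hom X Y) : hom M X -> Prop := fun v => f ∘ v = 0.

(** Passing to a syzygy gains one step of purity.  Let [v = b + c x_k] be in the
    kernel, with [b] in [I_k].  Then [f c x_k] is in [I_k], so [f c] is, by
    regularity, and purity of the image gives [f c = f c'] with [c'] in [I_k].
    Now [v = (b + c' x_k) + (c - c') x_k], where [c - c'] is in the kernel and
    [b + c' x_k] is an element of the kernel that lies in [I_k]. *)
Lemma pure_kernel k X Y (f : hom X Y) : (k <= d)%N ->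
  (forall j, (j < k)%N -> pure j (image f)) -> pure k (kernel f).
Proof.
elim: k => [|k IHk] kd imf v fv; first by [].
move=> [b [c [bI _ vE]]].
have fc : seq_span k (@full Y) (f ∘ c).
  apply: hom_regular => //; have := seq_span_full_map (- f) bI.
  rewrite (_ : - f ∘ b = (f ∘ c) ∘ (x k : hom M M)) //.
  by apply/eqP; rewrite compNm eq_sym -addr_eq0 addrC -compA -compDr -vE fv.
have [c' c'I cc'] : exists2 c', seq_span k (@full X) c' & f ∘ c' = f ∘ c.
  have : seq_span k (image f) (f ∘ c) by apply: imf => //; exists c.
  elim: (k) (f ∘ c) => [|j IHj] t; first by move=> ->; exists 0; rewrite ?compm0.
  move=> [a [l [/IHj [a' a'I <-] [l' ->] ->]]].
  exists (a' + l' ∘ (x j : hom M M)); last by rewrite compDr compA.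
  by exists a', l'.
exists (b + c' ∘ (x k : hom M M)), (c - c'); split.
- apply: IHk; first exact: ltnW.
  + by move=> j jk; apply: imf; apply: ltnW.
  + by rewrite /kernel compDr compA cc' -compA -compDr -vE.
  + by apply: seq_spanD => //; apply: seq_span_mul.
- by rewrite /kernel compBr cc' subrr.
- by rewrite vE compBl addrACA subrr addr0.
Qed.

End Purity.

(** * Cycles of unbounded exact complexes are free *)

Section RegularLocalEndo.
Context (C : addCat) (M : C) (addM : forall X : C, in_add M X).
Context (m : set (endo M)) (Rreg : @regular_local (endo M) m).

Lemma endo_comm (a b : endo M) : a * b = b * a.
Proof. by case: Rreg. Qed.

(** The endomorphism ring of [M] with its commutativity made structural. *)
Definition endo_com : comPzRingType :=
  HB.pack (endo M) (GRing.PzRing_hasCommutativeMul.Build (endo M) endo_comm).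

Let noeth : @noetherian endo_com. Proof. by case: Rreg. Qed.
Let loc : @local_ring endo_com m. Proof. by case: Rreg. Qed.

Lemma endo_ideal : ideal m. Proof. exact: (ideal_m loc). Qed.

Lemma endo_unit (a : endo M) : ~ m a -> exists b, b * a = 1.
Proof. exact: (unit_of_notin noeth loc). Qed.

Lemma endo_unit1B (a : endo M) : m a -> exists b, b * (1 - a) = 1.
Proof.
move=> ma; apply: endo_unit => m1a; apply: (maximal_proper loc).
rewrite -(subrK a 1); exact: (@idealD endo_com) endo_ideal m1a ma.
Qed.

Lemma endo_regular_sequence : exists (d : nat) (x : nat -> endo M),
  m = partial_ideal x d /\
  forall j c, (j < d)%N -> partial_ideal x j (c * x j) -> partial_ideal x j c.
Proof. exact: (@regular_local_sequence endo_com m Rreg). Qed.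

Lemma seq_span_coeff d (x : nat -> endo M) (mE : m = partial_ideal x d)
    (W Y : C) (f : hom W Y) n (e : 'I_n -> hom M W) (e' : 'I_n -> hom W M) j t :
  \sum_k e k ∘ e' k = idm W -> (j <= d)%N -> seq_span x j (image f) t ->
  exists a : 'I_n -> endo M, (forall l, m (a l)) /\ t = \sum_l (f ∘ e l) ∘ (a l : hom M M).
Proof.
move=> ee; have [m0 mD mM] := endo_ideal; elim: j t => [|j IHj] t jd.
  move=> ->; exists (fun=> 0); split=> //.
  by rewrite big1 // => l _; rewrite compm0.
move=> [t' [_ [/(IHj _ (ltnW jd)) [a [ma ->]] [w ->] ->]]].
exists (fun l => a l + (e' l ∘ w : endo M) * x j); split.
  move=> l; apply: mD => //; apply: mM; rewrite mE.
  exact: (@partial_ideal_gen endo_com x j d jd).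
rewrite -[w in LHS]comp1m -ee comp_suml comp_sumr comp_suml -big_split.
by apply: eq_bigr => l _; rewrite /= compDr !compA.
Qed.

(** Nakayama's lemma for the image of [f], which is finitely generated since its
    source lies in [add M]: if it equals its multiple by the maximal ideal, it is 0. *)
Lemma seq_nakayama d (x : nat -> endo M) (W Y : C) (f : hom W Y) :
  m = partial_ideal x d ->
  (forall w : hom M W, seq_span x d (image f) (f ∘ w)) -> f = 0.
Proof.
move=> mE fm; have [n [e [e' ee]]] := add_dual_basis (addM W).
have [m0 mD mM] := endo_ideal.
have [a aP] := choice (fun k => seq_span_coeff mE ee (leqnn d) (fm (e k))).
have fe : forall k, f ∘ e k = 0.
  apply: (@nakayama (endo M)^c (hmod M Y) m n (fun k => f ∘ e k) a) => //.
  - by move=> b c mc; rewrite [b * c]endo_comm; apply: (mM (b : endo M)); exact: mc.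
  - move=> b /endo_unit1B [u u1]; exists u.
    by apply: etrans u1; apply: endo_comm.
  - by move=> k; case: (aP k).
  - by move=> k; case: (aP k).
rewrite -[f]compm1 -ee comp_sumr big1 // => k _.
by rewrite compA fe comp0m.
Qed.

Section ExactSequence.
Context (E : int -> C) (del : forall i : int, hom (E i) (E (i + 1))).
Context (delK : forall i, del (i + 1) ∘ del i = 0).
Context (del_exact : forall i (w : hom M (E (i + 1))),
  del (i + 1) ∘ w = 0 -> exists u, w = del i ∘ u).

Lemma image_kernel i : image (del i) = kernel (del (i + 1)) :> (hom M _ -> Prop).
Proof.
apply/funext => w; apply/propext; split; last exact: del_exact.
by move=> [u ->]; rewrite /kernel compA delK comp0m.
Qed.

(** Each module of cycles is a kernel whose image is the next module of cycles;
    unboundedness to the right makes the induction on [k] possible in all degrees. *)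
Lemma exact_pure d (x : nat -> endo M) k i :
  (forall j c, (j < d)%N -> partial_ideal x j (c * x j) -> partial_ideal x j c) ->
  (k <= d)%N -> pure x k (@image C M _ _ (del i)).
Proof.
move=> regx; elim/ltn_ind: k i => k IHk i kd; rewrite image_kernel.
apply: (pure_kernel addM endo_comm regx kd) => j jk.
by apply: IHk => //; apply: leq_trans kd; apply: ltnW.
Qed.

(** The cycles in degree [i + 1 + 1] are free: [g] is given by a minimal system of
    generators, so its kernel lies in the multiple of the free module by the
    maximal ideal.  The kernel is also pure, hence equal to its own multiple by the
    maximal ideal, and it vanishes by Nakayama's lemma. *)
Lemma free_cover i : exists r (g : hom (copies M r) (E (i + 1 + 1))),
  (forall w : hom M _, del (i + 1 + 1) ∘ w = 0 <-> exists z, w = g ∘ z) /\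
  (forall z : hom M _, g ∘ z = 0 -> z = 0).
Proof.
have [d [x [mE regx]]] := endo_regular_sequence.
have [n [e [e' ee]]] := add_dual_basis (addM (E (i + 1))).
have [|r [v [vgen vJ]]] := @minimal_generators (endo M)^c (hmod M (E (i + 1 + 1))) m n
    (fun k => del (i + 1) ∘ e k).
  move=> a; have [|/endo_unit [b ba]] := pselect (m a); [by left|right].
  by exists b; apply: etrans ba; apply: endo_comm.
have [b [b' [bb' bb]]] := copies_basis M r.
pose g : hom (copies M r) (E (i + 1 + 1)) := \sum_k (v k : hom M _) ∘ b' k.
have gz (z : hom M (copies M r)) : g ∘ z = \sum_k (b' k ∘ z : (endo M)^c) *: v k.
  by rewrite /g comp_suml; apply: eq_bigr => k _; rewrite -compA.
have gE (w : hom M (E (i + 1 + 1))) : (exists u, w = del (i + 1) ∘ u) <-> exists z, w = g ∘ z.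
  split=> [[u ->]|[z ->]].
    have [|a aE] := proj1 (vgen (del (i + 1) ∘ u)).
      exists (fun k => e' k ∘ u); rewrite -[u in LHS]comp1m -ee comp_suml comp_sumr.
      by apply: eq_bigr => k _; rewrite hmod_scaleE !compA.
    exists (\sum_l b l ∘ (a l : hom M M)); rewrite aE gz; apply: eq_bigr => k _.
    rewrite !hmod_scaleE; congr (_ ∘ _); rewrite comp_sumr (bigD1 k) //= compA bb' eqxx comp1m.
    rewrite big1 ?addr0 // => l /negPf lk.
    by rewrite compA bb' eq_sym lk comp0m.
  have [|a aE] := proj2 (vgen (g ∘ z)); first by exists (fun k => b' k ∘ z); apply: gz.
  exists (\sum_k e k ∘ (a k : hom M M)); rewrite aE comp_sumr.
  by apply: eq_bigr => k _; rewrite hmod_scaleE compA.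
exists r, g; split=> [w|].
  rewrite -gE; split; [exact: del_exact | move=> [u ->]].
  by rewrite compA delK comp0m.
have [p pE] : exists p, del (i + 1) = g ∘ p.
  by apply: (add_lift (addM _)) => w; apply/gE; exists w.
have [q qE] : exists q, g = del (i + 1) ∘ q.
  by apply: (add_lift (addM _)) => w; apply/gE; exists w.
(* finite generation of the kernel of g: as p and q compare the covers g and
   del (i + 1) of the same module, it is the image of p del i and 1 - p q *)
pose f : hom (bip (E i) (copies M r)) (copies M r) :=
  (p ∘ del i) ∘ prj1 + (idm _ - p ∘ q) ∘ prj2.
have fE w : f ∘ w = p ∘ (del i ∘ (prj1 ∘ w)) + (prj2 ∘ w - p ∘ (q ∘ (prj2 ∘ w))) :> hom M _.
  by rewrite /f compDl -!compA compBl comp1m -!compA.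
have kerf (z : hom M _) : g ∘ z = 0 <-> exists w, z = f ∘ w.
  split=> [gz0|[w ->]].
    have [t tE] : exists t, q ∘ z = del i ∘ t.
      by apply: del_exact; rewrite compA -qE.
    exists (inj1 ∘ t + inj2 ∘ z); rewrite fE !(compDr prj1) !(compDr prj2).
    rewrite !(compA prj1) !(compA prj2) prj1_inj1 prj1_inj2 prj2_inj1 prj2_inj2.
    by rewrite !(comp1m, comp0m, compm0) addr0 !add0r -tE addrC subrK.
  rewrite fE compDr compBr !(compA g) -pE (compA (del _) (del _)) delK comp0m add0r.
  by rewrite (compA (del _)) -qE compA subrr.
have f0 : f = 0.
  apply: (seq_nakayama mE) => w.
  have kE : kernel g = image f :> (hom M _ -> Prop) by apply/funext => z; apply/propext/kerf.
  rewrite -kE; have gfw : kernel g (f ∘ w) by apply/kerf; exists w.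
  apply: (pure_kernel addM endo_comm regx (leqnn d)) => //.
    move=> j jd; have -> : image g = image (del (i + 1)) :> (hom M _ -> Prop).
      by apply/funext => u; apply/propext; split=> /gE.
    by apply: exact_pure regx (ltnW jd).
  apply: (seq_span_coord bb) => k; rewrite -mE; apply: (vJ (fun k => b' k ∘ (f ∘ w))).
  by rewrite -gz.
by move=> z /kerf [w ->]; rewrite f0 comp0m.
Qed.

End ExactSequence.
End RegularLocalEndo.

(** * Comparison of totally acyclic complexes *)

Section IntegerChoice.

Lemma PoszS n : Posz n + 1 = Posz n.+1.
Proof. by rewrite -[n.+1]addn1. Qed.

Lemma NegzS n : Negz n.+1 + 1 = Negz n.
Proof. by rewrite !NegzE -[n.+2]addn1 PoszD opprD addrNK. Qed.

(** Dependent choice in both directions from 0.  The transports along [PoszS] and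
    [NegzS] are confined to this proof. *)
Lemma int_dependent_choice (T : int -> Type) (G : forall i, T i -> Prop)
    (rel : forall i, T i -> T (i + 1) -> Prop) (x0 : T 0) :
  (forall i (x : T i), G i x -> exists2 y, G (i + 1) y & rel i x y) ->
  (forall i (y : T (i + 1)), G (i + 1) y -> exists2 x, G i x & rel i x y) ->
  G 0 x0 ->
  exists f : forall i, T i, f 0 = x0 /\ forall i, rel i (f i) (f (i + 1)).
Proof.
move=> fwd bwd Gx0; pose U i := {x : T i | G i x}.
have F i (x : U i) : {y : U (i + 1) | rel i (sval x) (sval y)}.
  case: x => x Gx; have [y Gy xy] := cid2 (fwd i x Gx).
  by exists (exist _ y Gy).
have B i (y : U (i + 1)) : {x : U i | rel i (sval x) (sval y)}.
  case: y => y Gy; have [x Gx xy] := cid2 (bwd i y Gy).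
  by exists (exist _ x Gx).
pose fp := nat_rect (fun n => U (Posz n)) (exist _ x0 Gx0)
  (fun n u => ecast i (U i) (PoszS n) (sval (F (Posz n) u))).
pose fn := nat_rect (fun n => U (Negz n)) (sval (B (Negz 0) (fp 0%N)))
  (fun n u => sval (B (Negz n.+1) (ecast i (U i) (esym (NegzS n)) u))).
pose f i : U i := match i with Posz n => fp n | Negz n => fn n end.
have fcast i j (e : i = j) : f i = ecast k (U k) (esym e) (f j) by case: j / e.
exists (fun i => sval (f i)); split=> // -[n|[|n]].
- rewrite (fcast _ _ (PoszS n)) /=.
  by case: _ / (PoszS n); apply: (svalP (F _ _)).
- exact: (svalP (B _ _)).
- rewrite (fcast _ _ (NegzS n)) /=; exact: (svalP (B (Negz n.+1) _)).
Qed.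

(** Removes the shift from statements about degree [i + 1]. *)
Lemma forall_int_succ (P : int -> Prop) : (forall i, P (i + 1)) -> forall i, P i.
Proof. by move=> PS i; rewrite -(subrK 1 i). Qed.

End IntegerChoice.

Section DualBasis.
Context (S : pzRingType) (P : lmodType S).

Lemma projective_dual_basis : fin_gen P -> projective P ->
  exists n (x : 'I_n -> P) (q : 'I_n -> {linear P -> S^o}),
    forall p, p = \sum_k (q k p : S) *: x k.
Proof.
move=> [n [x xgen]] projP.
pose ev (a : 'rV[S]_n) : P := \sum_k a 0 k *: x k.
have ev_lin : linear ev.
  move=> c a b; rewrite /ev scaler_sumr -big_split; apply: eq_bigr => k _ /=.
  by rewrite !mxE scalerDl scalerA.
pose evL : {linear 'rV[S]_n -> P} := HB.pack ev (GRing.isLinear.Build _ _ _ _ ev ev_lin).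
have [|g gE] := projP _ _ evL (idfun : {linear P -> P}).
  move=> y; have [a ->] := xgen y; exists (\row_k a k).
  by apply: eq_bigr => k _; rewrite mxE.
pose q k (p : P) : S^o := g p 0 k.
have q_lin k : linear (q k) by move=> c a b; rewrite /q linearP !mxE.
pose qL k : {linear P -> S^o} := HB.pack (q k) (GRing.isLinear.Build _ _ _ _ (q k) (q_lin k)).
exists n, x, qL.
by move=> p; rewrite -{1}[p]/(idfun p) -gE.
Qed.

Lemma linear_comb (V W : lmodType S) n (q : 'I_n -> {linear W -> S^o}) (c : 'I_n -> V) :
  exists g : {linear W -> V}, forall w, g w = \sum_k (q k w : S) *: c k.
Proof.
pose g w := \sum_k (q k w : S) *: c k.
have g_lin : linear g.
  move=> a v w; rewrite /g scaler_sumr -big_split; apply: eq_bigr => k _ /=.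
  by rewrite linearP scalerDl scalerA.
pose gL : {linear W -> V} := HB.pack g (GRing.isLinear.Build _ _ _ _ g g_lin).
by exists gL.
Qed.

End DualBasis.

Section Comparison.
Context (R : pzRingType).
Implicit Types C D : complex R.

(** Only the images of a dual basis need to be lifted. *)
Lemma cycle_lift C (P : rmodType R) i (h : {linear P -> C (i + 1)}) :
  acyclic C -> fin_gen P -> projective P -> (forall p, diff C (i + 1) (h p) = 0) ->
  exists g : {linear P -> C i}, forall p, h p = diff C i (g p).
Proof.
move=> acC fgP projP dh; have [n [x [q xq]]] := projective_dual_basis fgP projP.
have [c cE] := choice (fun k => acC i (h (x k)) (dh _)).
have [g gE] := linear_comb q c; exists g => p.
rewrite gE {1}[p]xq !linear_sum; apply: eq_bigr => k _.
by rewrite !linearZ /= cE.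
Qed.

(** Acyclicity of the dual complex extends linear forms; a dual basis of [P]
    reduces maps into [P] to linear forms. *)
Lemma boundary_extend D (P : rmodType R) i (h : {linear D (i + 1) -> P}) :
  dual_acyclic D -> fin_gen P -> projective P -> (forall x, h (diff D i x) = 0) ->
  exists g : {linear D (i + 1 + 1) -> P}, forall x, h x = g (diff D (i + 1) x).
Proof.
move=> acD fgP projP hd; have [n [x [q xq]]] := projective_dual_basis fgP projP.
have hk k y : (q k \o h) (diff D i y) = 0 by rewrite /= hd linear0.
have [v vE] := choice (fun k => acD i (q k \o h : {linear _ -> _}) (hk k)).
have [g gE] := linear_comb v x; exists g => y.
rewrite gE [LHS]xq; apply: eq_bigr => k _.
by have /= <- := vE k y.
Qed.

(** Extension to the left uses projectivity and acyclicity of [C], extension to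
    the right acyclicity of the dual of [D].  The condition that cycles go to
    cycles is carried along in both directions. *)
Lemma chain_map_extend D C (f0 : {linear D 0 -> C 0}) : tac_proj D -> tac_proj C ->
  (forall x, diff D 0 x = 0 -> diff C 0 (f0 x) = 0) ->
  exists f : chain_map D C, forall x, f 0 x = f0 x.
Proof.
move=> [projD [acD dacD]] [projC [acC dacC]] f0Z.
have [|||f [f0E fE]] := @int_dependent_choice (fun i => {linear D i -> C i})
  (fun i f => forall x, diff D i x = 0 -> diff C i (f x) = 0)
  (fun i f g => forall x, g (diff D i x) = diff C i (f x)) f0 => //.
- apply: forall_int_succ => i f fZ; have [fgP projP] := projC (i + 1 + 1).
  have [|g gE] := @boundary_extend D _ i (diff C (i + 1) \o f) dacD fgP projP.
    by move=> x /=; apply: fZ; rewrite diffK.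
  exists g => [x /acD [y ->]|x]; rewrite -gE //=; exact: diffK.
- move=> i g gZ; have [fgP projP] := projD i.
  have [|f fE] := @cycle_lift C _ i (g \o diff D i) acC fgP projP.
    by move=> x /=; apply: gZ; rewrite diffK.
  by exists f => [x dx|x]; rewrite -fE //= dx linear0.
by exists (ChainMap fE) => x /=; rewrite f0E.
Qed.

(** The homotopy starts from 0 between [D 1] and [C 0].  A component [s] in degree
    [i] can be continued when [h - d s] vanishes on the boundaries of [D]; this
    condition propagates in both directions. *)
Lemma chain_map_null D C (h : chain_map D C) : tac_proj D -> tac_proj C ->
  (forall x, h 0 x = 0) -> chm_null h.
Proof.
move=> [projD [acD dacD]] [projC [acC dacC]] h0.
have [|||s [_ sE]] := @int_dependent_choice (fun i => {linear D (i + 1) -> C i})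
  (fun i s => forall x, h (i + 1) (diff D i x) = diff C i (s (diff D i x)))
  (fun i s t => forall x, h (i + 1) x = diff C i (s x) + t (diff D (i + 1) x)) \0.
- move=> i s sd; have [fgP projP] := projC (i + 1).
  have [|t tE] := @boundary_extend D _ i (h (i + 1) \- (diff C i \o s)) dacD fgP projP.
    by move=> x /=; rewrite sd subrr.
  have e x : h (i + 1) x = diff C i (s x) + t (diff D (i + 1) x).
    by rewrite -tE /= [RHS]addrC subrK.
  exists t => // x; rewrite chmE e linearD diffK add0r; by [].
- move=> i t td; have [fgP projP] := projD (i + 1).
  have [|s sE] := @cycle_lift C _ i (h (i + 1) \- (t \o diff D (i + 1))) acC fgP projP.
    by move=> x /=; rewrite linearB /= -chmE td subrr.
  have e x : h (i + 1) x = diff C i (s x) + t (diff D (i + 1) x).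
    by rewrite -sE /= subrK.
  by exists s => // x; rewrite e diffK linear0 addr0.
- by move=> x; rewrite chmE h0 /= !linear0.
by exists s.
Qed.

Lemma homotopic_of_degree0 D C (f g : chain_map D C) : tac_proj D -> tac_proj C ->
  (forall x, f 0 x = g 0 x) ->
  cls (chain_homotopy R) (f : @hom (complex_cat R) D C) = cls (chain_homotopy R) (g : @hom (complex_cat R) D C).
Proof.
move=> tD tC fg; apply/eq_cls; apply: chain_map_null => // x.
by rewrite chmDE chmNE fg subrr.
Qed.

(** A totally acyclic complex is determined up to homotopy by its cycles in degree 0. *)
Lemma homotopy_equiv_of_degree0 D C (u : {linear D 0 -> C 0}) (v : {linear C 0 -> D 0}) :
  tac_proj D -> tac_proj C -> cancel u v -> cancel v u ->
  (forall x, diff D 0 x = 0 <-> diff C 0 (u x) = 0) ->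
  exists f : chain_map D C, is_iso (cls (chain_homotopy R) (f : @hom (complex_cat R) D C)).
Proof.
move=> tD tC uv vu Z.
have [|f fE] := chain_map_extend (f0 := u) tD tC; first by move=> x /Z.
have [|g gE] := chain_map_extend (f0 := v) tC tD; first by move=> x; rewrite -{1}(vu x) => /Z.
exists f, (cls (chain_homotopy R) (g : @hom (complex_cat R) C D)).
rewrite -!cls_comp; split.
  by apply: (homotopic_of_degree0 (g := chm_id D)) => // x; rewrite /= fE gE.
by apply: (homotopic_of_degree0 (g := chm_id C)) => // x; rewrite /= gE fE.
Qed.

End Comparison.

(** * Factorizations from totally acyclic complexes *)

Section Lifting.
Context (C : addCat) (eta : nat_trans (idF C) (idF C)) (M : C).
Context (addM : forall X : C, in_add M X).
Context (etaM : @regular_element (endo M) (eta M)).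
Implicit Types X Y Z : C.

Lemma eta_comm X Y (f : hom X Y) : (eta Y : hom Y Y) ∘ f = f ∘ eta X.
Proof. by have /= -> := ntcE eta f. Qed.

(** Regularity of [eta M], transported to [add M]. *)
Lemma eta_cancel X Y (f g : hom X Y) : f ∘ eta X = g ∘ eta X -> f = g.
Proof.
move=> fg; apply: (add_faithful (addM X)) => w.
apply/eqP; rewrite -subr_eq0; apply/eqP/(eta_regular addM etaM).
by rewrite compBl -!compA -eta_comm !compA fg subrr.
Qed.

Lemma GbarM (a b : hom M M) : (epi eta a : Gbar eta M) * epi eta b = epi eta (a ∘ b).
Proof. exact: ebar_act_pi. Qed.

Lemma ebar_full X Y (u : {linear ebar_mod eta M X -> ebar_mod eta M Y}) :
  exists h : hom X Y, forall w, u w = ebar_map h w.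
Proof.
have [n [x [y xy]]] := add_dual_basis (addM X).
have [c cE] := choice (fun k => @epiP C eta M Y (u (epi eta (x k)))).
exists (\sum_(k < n) c k ∘ y k) => q; have [w ->] := epiP q.
rewrite ebar_map_pi comp_suml.
rewrite (big_morph (@epi _ eta M Y) (@epiD _ eta M Y) (@epi0 _ eta M Y)).
rewrite -[w in LHS]comp1m -xy comp_suml.
rewrite (big_morph (@epi _ eta M X) (@epiD _ eta M X) (@epi0 _ eta M X)).
rewrite linear_sum; apply: eq_bigr => k _.
by rewrite -!compA -!epiZ linearZ cE.
Qed.

Lemma ebar_map_eq0 X Y (f : hom X Y) :
  (forall w : ebar_mod eta M X, ebar_map f w = 0) -> exists t, f = t ∘ eta X.
Proof.
move=> f0; have [n [x [y xy]]] := add_dual_basis (addM X).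
have fx k : exists t : hom M Y, f ∘ x k = t ∘ eta M.
  by apply/epi_eq0; rewrite -ebar_map_pi f0.
have [t tE] := choice fx.
exists (\sum_k t k ∘ y k); rewrite -[LHS]compm1 -xy comp_sumr comp_suml.
by apply: eq_bigr => k _; rewrite compA tE -!compA eta_comm.
Qed.

Lemma ebar_map_eq X Y (f g : hom X Y) :
  (forall w : ebar_mod eta M X, ebar_map f w = ebar_map g w) ->
  exists t, f = g + t ∘ eta X.
Proof.
move=> fg; have [|t tE] := @ebar_map_eq0 X Y (f - g).
  by move=> w; rewrite ebar_mapD ebar_mapN fg subrr.
by exists t; rewrite -tE addrC subrK.
Qed.

End Lifting.

Section LocalReduction.
Context (C : addCat) (eta : nat_trans (idF C) (idF C)) (M : C).
Context (addM : forall X : C, in_add M X).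
Context (etaM : @regular_element (endo M) (eta M)).
Context (m : set (endo M)) (Rreg : @regular_local (endo M) m).
Implicit Types X Y Z : C.

(** An isomorphism of [P] with a reduced module [Hom(M, X) / Hom(M, X) eta]. *)
Record trivialization (P : rmodType (Gbar eta M)) := Trivialization {
  triv_obj : C;
  triv_map : {linear ebar_mod eta M triv_obj -> P};
  triv_inv : {linear P -> ebar_mod eta M triv_obj};
  triv_mapK : cancel triv_map triv_inv;
  triv_invK : cancel triv_inv triv_map }.

(** A finitely generated projective module over a local ring is free.  Let [u] be
    the cover by minimal generators, and [v] a section of it.  The elements
    [z k = e_k - v u e_k], for the standard basis [e], span the kernel of [u], so
    their coordinates lie in the maximal ideal; as [1 - v u] fixes them, they are
    combinations of each other with these coefficients, and Nakayama applies. *)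
Lemma ebar_free (P : rmodType (Gbar eta M)) : fin_gen P -> projective P ->
  exists r (u : {linear ebar_mod eta M (copies M r) -> P})
    (v : {linear P -> ebar_mod eta M (copies M r)}), cancel u v /\ cancel v u.
Proof.
move=> [n [x xgen]] projP.
pose J (a : (Gbar eta M)^c) := exists b : endo M, m b /\ a = epi eta b.
have [m0 mD mM] := endo_ideal Rreg.
have comm := endo_comm Rreg.
have [|r [w [wgen wJ]]] := @minimal_generators (Gbar eta M)^c P J n x.
  move=> a; have [b ->] := @epiP C eta M M a.
  have [mb|/(endo_unit Rreg) [c cb]] := pselect (m b); first by left; exists b.
  right; exists (epi eta c); apply: etrans (GbarM eta b c) _.
  by congr (epi eta _); apply: etrans (comm b c) cb.
have [b [b' [b'b bb]]] := copies_basis M r.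
pose u y : P := \sum_k (ebar_map (b' k) y : (Gbar eta M)^c) *: w k.
have u_lin : linear u.
  move=> c y z; rewrite /u scaler_sumr -big_split; apply: eq_bigr => k _ /=.
  by rewrite linearP scalerDl scalerA.
have [uL uE] : exists uL : {linear ebar_mod eta M (copies M r) -> P}, forall y, uL y = u y.
  pose uL : {linear ebar_mod eta M (copies M r) -> P} :=
    HB.pack u (GRing.isLinear.Build _ _ _ _ u u_lin).
  by exists uL.
have expand (y : ebar_mod eta M (copies M r)) :
    y = \sum_k (ebar_map (b' k) y : (Gbar eta M)^c) *: epi eta (b k).
  have [z ->] := epiP y; rewrite -[z in LHS]comp1m -bb comp_suml.
  rewrite (big_morph (@epi _ eta M _) (@epiD _ eta M _) (@epi0 _ eta M _)).
  by apply: eq_bigr => k _; rewrite ebar_map_pi epiZ compA.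
have ub k : u (epi eta (b k)) = w k.
  rewrite /u (bigD1 k) //= ebar_map_pi b'b eqxx.
  rewrite -[epi _ _]/(1 : (Gbar eta M)^c) scale1r big1 ?addr0 // => l /negPf lk.
  by rewrite ebar_map_pi b'b lk epi0 scale0r.
have usurj p : exists y, uL y = p.
  have [a aE] := xgen p.
  have [|c ->] := proj1 (wgen p); first by exists a.
  exists (\sum_k c k *: epi eta (b k)); rewrite linear_sum.
  by apply: eq_bigr => k _; rewrite linearZ /= uE ub.
have [v vE] := projP _ _ uL (idfun : {linear P -> P}) usurj.
pose z k := epi eta (b k) - v (uL (epi eta (b k))).
have zlin y : y - v (uL y) = \sum_k (ebar_map (b' k) y : (Gbar eta M)^c) *: z k.
  have -> : v (uL y) =
      \sum_k (ebar_map (b' k) y : (Gbar eta M)^c) *: v (uL (epi eta (b k))).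
    rewrite [in LHS](expand y) !linear_sum; apply: eq_bigr => k _.
    by rewrite linearZ /= linearZ.
  rewrite {1}(expand y) -sumrB; apply: eq_bigr => k _.
  by rewrite scalerBr.
have uz k : u (z k) = 0 by rewrite -uE linearB vE subrr.
have z0 k : z k = 0.
  apply: (@nakayama (Gbar eta M)^c _ J r z (fun k l => ebar_map (b' l) (z k))) => //.
  - move=> _ _ [c [mc ->]] [c' [mc' ->]]; exists (c + c'); split; first exact: mD.
    by rewrite epiD.
  - move=> c _ [c' [mc' ->]]; have [c0 ->] := @epiP C eta M M c.
    exists (c' * c0); split; last exact: (GbarM eta c' c0).
    by rewrite comm; apply: mM.
  - move=> _ [c [mc ->]]; have [c' c'E] := endo_unit1B Rreg mc.
    exists (epi eta c'); have e1 : 1 - (epi eta c : (Gbar eta M)^c) = epi eta (idm M - c).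
      by rewrite epiD epiN.
    rewrite e1; apply: etrans (GbarM eta _ c') _; congr (epi eta _).
    exact: etrans (comm _ c') c'E.
  - by move=> i j; apply: (wJ (fun l => ebar_map (b' l) (z i))); apply: uz.
  - by move=> i; rewrite -zlin uE uz linear0 subr0.
exists r, uL, v; split=> [y|p]; last exact: vE.
apply/esym/eqP; rewrite -subr_eq0 zlin big1 // => k _.
by rewrite z0 scaler0.
Qed.

(** A complex over the reduction lifts to maps [D] with [D D = T eta]; [Dexact] is
    exactness of the reduced complex. *)
Section Factorization.
Context (X : int -> C) (D : forall i : int, hom (X i) (X (i + 1))).
Context (T : forall i : int, hom (X i) (X (i + 1 + 1))).
Context (DD : forall i, D (i + 1) ∘ D i = T i ∘ eta (X i)).
Context (Dexact : forall i (w : hom M (X (i + 1))),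
  (exists t, D (i + 1) ∘ w = t ∘ eta M) -> exists a b, w = D i ∘ a + b ∘ eta M).

Local Notation total_obj i := (bip (X i) (X (i + 1))).
(** The differential of the resolution over the endomorphism ring, built from the
    resolutions [X i --eta--> X i] of the modules of the reduced complex; [T]
    corrects the failure of [D D = 0]. *)
Definition total_diff i : hom (total_obj i) (total_obj (i + 1)) :=
  bip_mx (D i) (- (eta (X (i + 1)) : hom (X (i + 1)) _)) (T i) (- D (i + 1)).

Lemma TD_comm i : T (i + 1) ∘ D i = D (i + 1 + 1) ∘ T i.
Proof.
by apply: (eta_cancel addM etaM); rewrite -!compA -DD -eta_comm !compA DD.
Qed.

Lemma total_diffK i : total_diff (i + 1) ∘ total_diff i = 0.
Proof.
rewrite bip_mxM !(compNm, compmN) !opprK TD_comm !DD !eta_comm !subrr !addNr /bip_mx.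
by rewrite !comp0m !addr0 !compm0 addr0.
Qed.

(** The second equation of a cycle, [T v = D w] for the components [v] and [w],
    follows from the first after composition with [eta], which is cancellable. *)
Lemma total_diff_eq0 i (w : hom M (total_obj i)) :
  total_diff i ∘ w = 0 <-> D i ∘ (prj1 ∘ w) = (prj2 ∘ w) ∘ eta M.
Proof.
have p1 : prj1 ∘ (total_diff i ∘ w) = D i ∘ (prj1 ∘ w) - (prj2 ∘ w) ∘ eta M.
  by rewrite compA /total_diff prj1_mx compDl -!compA compNm eta_comm -!compA.
have p2 : prj2 ∘ (total_diff i ∘ w) = T i ∘ (prj1 ∘ w) - D (i + 1) ∘ (prj2 ∘ w).
  by rewrite compA /total_diff prj2_mx compDl -!compA compNm.
split=> [w0|Dw].
  by apply/eqP; rewrite -subr_eq0 -p1 w0 compm0.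
apply: bip_ext; rewrite compm0 ?p1 ?p2; first by rewrite Dw subrr.
apply/eqP; rewrite subr_eq0; apply/eqP/(eta_cancel addM etaM).
by rewrite -compA -(eta_comm _ (prj1 ∘ w)) (compA (T i)) -DD -(compA _ (D i)) Dw compA.
Qed.

Lemma total_diff_exact i (w : hom M (total_obj (i + 1))) :
  total_diff (i + 1) ∘ w = 0 -> exists u, w = total_diff i ∘ u.
Proof.
move=> /total_diff_eq0 Dw.
have [|a [b ab]] := Dexact (w := prj1 ∘ w); first by exists (prj2 ∘ w).
exists (inj1 ∘ a + inj2 ∘ (- b)); apply: bip_ext; rewrite compA /total_diff.
  by rewrite prj1_mx compDl -!compA prj1_pair prj2_pair compNm compmN opprK eta_comm.
rewrite prj2_mx compDl -!compA prj1_pair prj2_pair compNm compmN opprK.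
apply: (eta_cancel addM etaM); rewrite -Dw ab compDl compDr.
by rewrite -(compA (T i)) -eta_comm (compA (T i)) -DD !compA.
Qed.

Lemma free_total_cycles i : exists r (g : hom (copies M r) (total_obj i)),
  (forall w : hom M _, total_diff i ∘ w = 0 <-> exists z, w = g ∘ z) /\
  (forall z : hom M _, g ∘ z = 0 -> z = 0).
Proof.
move: i; apply: forall_int_succ; apply: forall_int_succ => i.
exact: (free_cover addM Rreg total_diffK total_diff_exact i).
Qed.

(** [f2] is the inclusion into [X i] of the elements with [D w] divisible by [eta],
    a free submodule by [free_total_cycles]; it contains [X i eta], so [eta]
    factors through it. *)
Lemma cycles_factorization i : exists Y (f1 : hom (X i) Y) (f2 : hom Y (X i)),
  [/\ f2 ∘ f1 = eta (X i), f1 ∘ f2 = eta Y &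
      forall w : hom M (X i), (exists t, f1 ∘ w = t ∘ eta M) <-> (exists t, D i ∘ w = t ∘ eta M)].
Proof.
have [r [g [gE g_inj]]] := free_total_cycles i.
have [f2 f2g] : exists f2, f2 = prj1 ∘ g by exists (prj1 ∘ g).
have Dg z : D i ∘ (f2 ∘ z) = (prj2 ∘ (g ∘ z)) ∘ eta M :> hom M _.
  by rewrite f2g -(compA prj1); apply/total_diff_eq0/gE; exists z.
have f2E (w : hom M (X i)) : (exists t, D i ∘ w = t ∘ eta M) <-> exists z, w = f2 ∘ z.
  split=> [[t Dw]|[z ->]]; last by exists (prj2 ∘ (g ∘ z)).
  have [|z zE] := proj1 (gE (inj1 ∘ w + inj2 ∘ t)).
    by apply/total_diff_eq0; rewrite prj1_pair prj2_pair.
  by exists z; rewrite f2g -compA -zE prj1_pair.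
have f2_inj (z : hom M _) : f2 ∘ z = 0 -> z = 0.
  move=> z0; apply: g_inj; apply: bip_ext; rewrite compm0; first by rewrite compA -f2g.
  by apply: (eta_cancel addM etaM); rewrite comp0m -Dg z0 compm0.
have [f1 f1E] : exists f1, (eta (X i) : hom (X i) _) = f2 ∘ f1.
  apply: (add_lift (addM _)) => w; apply/f2E; exists (D i ∘ w).
  by rewrite eta_comm compA.
have f12 : f1 ∘ f2 = eta (copies M r).
  apply: (add_faithful (addM _)) => w.
  apply/eqP; rewrite -subr_eq0; apply/eqP/f2_inj.
  by rewrite compBr !compA -f1E eta_comm subrr.
exists (copies M r), f1, f2; split=> // w; rewrite f2E.
split=> [[t f1w]|[z ->]]; last by exists z; rewrite compA f12 eta_comm.
exists t; apply: (eta_cancel addM etaM).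
by rewrite -eta_comm f1E -!compA f1w.
Qed.

End Factorization.

Lemma ktac_factorization (K : complex (Gbar eta M)) : tac_proj K ->
  exists F : fact eta, exists f : chain_map (per_cpx M F) K,
    is_iso (cls (chain_homotopy _) (f : @hom (complex_cat (Gbar eta M)) _ _)).
Proof.
move=> tK; have [projK [acK dacK]] := tK.
have triv i : trivialization (K i).
  have [fgK prK] := projK i.
  have [r /cid [u /cid [v [uK vK]]]] := cid (ebar_free fgK prK).
  exact: (Trivialization uK vK).
pose X i := triv_obj (triv i); pose u i := triv_map (triv i); pose v i := triv_inv (triv i).
have uK i : cancel (u i) (v i) := @triv_mapK _ (triv i).
have vK i : cancel (v i) (u i) := @triv_invK _ (triv i).
have exD i : {D : hom (X i) (X (i + 1)) |
    forall w, v (i + 1) (diff K i (u i w)) = ebar_map D w}.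
  exact: cid (ebar_full addM (v (i + 1) \o diff K i \o u i)).
pose D i := sval (exD i).
have DE i w : ebar_map (D i) w = v (i + 1) (diff K i (u i w)).
  by rewrite (svalP (exD i)).
have exT i : {T : hom (X i) (X (i + 1 + 1)) | D (i + 1) ∘ D i = T ∘ eta (X i)}.
  apply: cid; apply: (ebar_map_eq0 addM) => w.
  by rewrite ebar_mapM !DE vK diffK linear0.
have D0 i w : ebar_map (D i) w = 0 <-> diff K i (u i w) = 0.
  split=> [|dw]; last by rewrite DE dw linear0.
  by rewrite DE => /(congr1 (u (i + 1))); rewrite vK linear0.
have Dexact i (w : hom M (X (i + 1))) : (exists t, D (i + 1) ∘ w = t ∘ eta M) ->
    exists a b, w = D i ∘ a + b ∘ eta M.
  move=> /epi_eq0; rewrite -ebar_map_pi => /D0 /acK [y yE].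
  have [a aE] := epiP (v i y); exists a.
  have [|b bE] := proj1 (@eq_epi C eta M _ w (D i ∘ a)).
    by rewrite -ebar_map_pi DE -aE vK -yE uK.
  by exists b; rewrite -bE [RHS]addrC subrK.
have [Y [f1 [f2 [f21 f12 fE]]]] :=
  cycles_factorization (fun i => svalP (exT i)) Dexact 0.
pose F : fact eta := Fact f21 f12.
exists F; apply: (@homotopy_equiv_of_degree0 _ (per_cpx M F) K (u 0) (v 0)).
- exact: per_tac_proj.
- exact: tK.
- exact: uK.
- exact: vK.
move=> x; have [w ->] := epiP x; rewrite -D0 ebar_map_pi.
apply: iff_trans (iff_sym (epi_eq0 _ _)); rewrite -fE -epi_eq0.
by rewrite -ebar_map_pi.
Qed.

End LocalReduction.

(** * The equivalence *)

Section FullyFaithfulDense.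
Context (A B : preaddCat) (F : functor A B).

Lemma equivalence_of_fully_faithful_dense :
  (forall X Y (g : hom (F X) (F Y)), exists f, fmap F f = g) ->
  (forall (X Y : A) (f f' : hom X Y), fmap F f = fmap F f' -> f = f') ->
  (forall Y, exists X (e : hom (F X) Y), is_iso e) ->
  is_equivalence F.
Proof.
move=> full faithful dense.
have [G0 /(_ _)/cid eP] := choice dense.
pose e Y := sval (eP Y).
have e'P Y : {e' | e' ∘ e Y = idm _ /\ e Y ∘ e' = idm _} by apply: cid (svalP (eP Y)).
pose e' Y := sval (e'P Y).
have e'e Y : e' Y ∘ e Y = idm _ by case: (svalP (e'P Y)).
have ee' Y : e Y ∘ e' Y = idm _ by case: (svalP (e'P Y)).
pose lift X Y (g : hom (F X) (F Y)) := sval (cid (full X Y g)).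
have liftE X Y (g : hom (F X) (F Y)) : fmap F (lift X Y g) = g := svalP (cid (full X Y g)).
pose G1 X Y (f : hom X Y) : hom (G0 X) (G0 Y) := lift _ _ (e' Y ∘ f ∘ e X).
have G1_id X : G1 _ _ (idm X) = idm (G0 X).
  by apply: faithful; rewrite liftE compm1 e'e fmap1.
have G1_comp X Y Z (g : hom Y Z) (f : hom X Y) : G1 _ _ (g ∘ f) = G1 _ _ g ∘ G1 _ _ f.
  apply: faithful; rewrite fmapM !liftE -!compA (compA (e _)) ee' comp1m.
  by rewrite !compA.
pose G := @Functor B A G0 G1 G1_id G1_comp.
have a_nat X Y (f : hom X Y) :
    lift _ _ (e (F Y)) ∘ fmap (compF G F) f = fmap (idF A) f ∘ lift _ _ (e (F X)).
  apply: faithful; rewrite !fmapM !liftE /= ?liftE.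
  by rewrite !compA ee' comp1m.
have b_nat X Y (f : hom X Y) : e Y ∘ fmap (compF F G) f = fmap (idF B) f ∘ e X.
  by rewrite /= liftE !compA ee' comp1m.
exists G, (@NatTrans A A (compF G F) (idF A) (fun X => lift _ X (e (F X))) a_nat),
  (@NatTrans B B (compF F G) (idF B) e b_nat); split=> X /=.
  exists (lift _ _ (e' (F X))).
  by split; apply: faithful; rewrite fmapM !liftE fmap1.
by exists (e' X).
Qed.

End FullyFaithfulDense.

Section PeriodicFunctor.
Context (C : addCat) (eta : nat_trans (idF C) (idF C)) (M : C).
Context (addM : forall X : C, in_add M X).
Context (etaM : @regular_element (endo M) (eta M)).
Implicit Types X Y : fact eta.

Lemma fac_f2_cancel (W : C) Y (v w : hom W (fac2 Y)) :
  fac_f2 Y ∘ v = fac_f2 Y ∘ w -> v = w.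
Proof.
move=> vw; apply: (eta_cancel addM etaM).
by rewrite -!eta_comm -fac_f1f2 -!compA vw.
Qed.

(** Lift [f] in degrees 0 and -1 to [h] and [k].  They commute with [fac_f2] up to
    a multiple [u] of [eta], which is absorbed by correcting [k] by [fac_f1 u];
    compatibility with [fac_f1] then follows by cancelling [fac_f2]. *)
Lemma per_full X Y (f : chain_map (per_cpx M X) (per_cpx M Y)) :
  exists phi : fact_hom X Y, forall x, f 0 x = per_map M phi 0 x.
Proof.
have [h hE] := ebar_full addM (f 0 : {linear ebar_mod eta M (fac1 X) -> ebar_mod eta M (fac1 Y)}).
have [k kE] := ebar_full addM (f (-1) : {linear ebar_mod eta M (fac2 X) -> ebar_mod eta M (fac2 Y)}).
have [|u uE] := @ebar_map_eq C eta M addM (fac2 X) (fac1 Y) (h ∘ fac_f2 X) (fac_f2 Y ∘ k).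
  by move=> w; rewrite !ebar_mapM -kE -hE; apply: (@chmE _ _ _ f (-1) w).
have e2 : h ∘ fac_f2 X = fac_f2 Y ∘ (k + fac_f1 Y ∘ u).
  by rewrite uE compDr compA fac_f2f1 eta_comm.
have e1 : (k + fac_f1 Y ∘ u) ∘ fac_f1 X = fac_f1 Y ∘ h.
  by apply: fac_f2_cancel; rewrite !compA -e2 -compA !fac_f2f1 eta_comm.
exists (mk_fact_hom e1 e2) => x; exact: hE.
Qed.

(** The two components of the homotopy around degree 0 lift up to a multiple [u]
    of [eta], which is absorbed by correcting one of them by [u fac_f2]. *)
Lemma per_faithful X Y (phi : fact_hom X Y) :
  chm_null (per_map M phi) -> fact_null phi.
Proof.
move=> [s sE].
have [t2 t2E] := ebar_full addM (s (-1) : {linear ebar_mod eta M (fac1 X) -> ebar_mod eta M (fac2 Y)}).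
have [t1 t1E] := ebar_full addM (s (-1 + 1) : {linear ebar_mod eta M (fac2 X) -> ebar_mod eta M (fac1 Y)}).
have [|u uE] := @ebar_map_eq C eta M addM (fac1 X) (fac1 Y) phi.1 (fac_f2 Y ∘ t2 + t1 ∘ fac_f1 X).
  by move=> w; rewrite ebar_mapD !ebar_mapM -t2E -t1E; apply: (sE (-1) w).
have e1 : phi.1 = (t1 + u ∘ fac_f2 X) ∘ fac_f1 X + fac_f2 Y ∘ t2.
  by rewrite uE compDl -[(u ∘ _) ∘ _]compA fac_f2f1 [X in X + _]addrC addrAC.
exists (t1 + u ∘ fac_f2 X), t2; split=> //.
apply: fac_f2_cancel; rewrite -fact_homE2 e1 compDl compDr -!compA fac_f1f2.
by rewrite (compA (fac_f2 Y) (fac_f1 Y)) fac_f2f1 eta_comm addrC.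
Qed.

End PeriodicFunctor.

Theorem theorem3p7 (C : addCat) (eta : nat_trans (idF C) (idF C)) (M : C)
  (addM : forall X : C, in_add M X)
  (eta_reg : @regular_element (endo M) (eta M))
  (m : set (endo M)) (Gamma_reg : @regular_local (endo M) m)
  (eta_m2 : @ideal_mul (endo M) m m (eta M)) :
  is_equivalence (HFact_to_Ktac addM eta_reg).
Proof.
have fmapE (X Y : fact eta) (phi : fact_hom X Y) :
    fmap (HFact_to_Ktac addM eta_reg) (cls (fact_homotopy eta) (phi : @hom (fact_cat eta) X Y)) =
    cls (chain_homotopy (Gbar eta M)) (per_map M phi : @hom (complex_cat _) _ _).
  exact: (@qmap_cls _ _ _ _ _ (@perD C eta M) (@per_null C eta M)).
have tac X := per_tac_proj addM eta_reg X.
apply: equivalence_of_fully_faithful_dense.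
- move=> X Y g; have [f ->] :=
    @clsP (complex_cat _) (chain_homotopy _) (per_cpx M X) (per_cpx M Y) g.
  have [phi phiE] := per_full addM eta_reg f.
  exists (cls (fact_homotopy eta) (phi : @hom (fact_cat eta) X Y)).
  rewrite fmapE; apply: (homotopic_of_degree0 (tac X) (tac Y)) => x.
  by rewrite phiE.
- move=> X Y f g; have [phi ->] := clsP f; have [psi ->] := clsP g.
  rewrite !fmapE => /eq_cls null; apply/eq_cls; apply: (per_faithful addM eta_reg).
  suff -> : per_map M (phi - psi) = per_map M phi - per_map M psi by [].
  apply: (addIr (per_map M psi)); rewrite subrK.
  by rewrite -[LHS](@perD C eta M X Y (phi - psi) psi) subrK.
- move=> [K tK]; have [F [f f_iso]] := ktac_factorization addM eta_reg Gamma_reg tK.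
  by exists F, (cls (chain_homotopy _) (f : @hom (complex_cat _) _ _)).
Qed.
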